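(* Let $f\colon\mathbb{R}^n\to\mathbb{R}^n$ be a continuous definable mapping. Assume that there exists a locally Riemann integrable function $c\colon[0,+\infty)\to(0,+\infty)$ such that $$\int_0^\infty c(t)\,dt=\infty\quad\text{and}\quad \nu_f(x)\ge c(\|x\|)>0\quad\text{for all } x\in\mathbb{R}^n.$$ Then $f$ is a global homeomorphism (i.e. a homeomorphism of $\mathbb{R}^n$ onto $\mathbb{R}^n$).
   Context: Fix an o-minimal structure on $(\mathbb{R},+,\cdot)$, i.e. a sequence $(\mathcal{D}_n)_{n\in\mathbb{N}}$ such that: (a) $\mathcal{D}_n$ is a Boolean algebra of subsets of $\mathbb{R}^n$; (b) $X\in\mathcal{D}_m$, $Y\in\mathcal{D}_n$ imply $X\times Y\in\mathcal{D}_{m+n}$; (c) if $X\in\mathcal{D}_{n+1}$ then $\pi(X)\in\mathcal{D}_n$, where $\pi\colon\mathbb{R}^{n+1}\to\mathbb{R}^n$ is the projection on the first $n$ coordinates; (d) $\mathcal{D}_n$ contains all algebraic subsets of $\mathbb{R}^n$; (e) each set in $\mathcal{D}_1$ is a finite union of points and intervals. A set is definable if it belongs to some $\mathcal{D}_n$; a mapping is definable if its graph is definable. (The function $c$ is not assumed definable.) $\mathbb{B}_r(x)$ is the open Euclidean ball of center $x$ and radius $r$; $\mathrm{co}$ denotes convex hull. For $A\in\mathbb{R}^{n\times n}$, $\sigma(A):=\inf_{\|v\|=1}\|Av\|$. $B_f$ is the set of points of $\mathbb{R}^n$ at which $f$ is not of class $C^1$ (i.e. $f$ is not $C^1$ on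 any neighbourhood of the point); it is a definable nowhere dense set. For $x\in\mathbb{R}^n\setminus B_f$, $df(x)$ is the derivative of $f$ at $x$; for $U\subset\mathbb{R}^n$, $df(U):=\{df(x): x\in U\setminus B_f\}$. For $x\in\mathbb{R}^n$, $$\nu_f(x):=\lim_{r\to0^+}\ \inf_{A\in\mathrm{co}(df(\mathbb{B}_r(x)))}\sigma(A)\in[0,+\infty].$$ *)

(* Defs.v *)
From mathcomp Require Import all_boot all_order all_algebra.
From mathcomp Require Import all_classical all_reals all_analysis.
(* The notations of mpoly clash with those of all_analysis. *)
From mathcomp Require Import -(notations) mpoly.

Set Implicit Arguments.
Unset Strict Implicit.
Unset Printing Implicit Defensive.

Import Order.TTheory GRing.Theory Num.Theory.
Import numFieldNormedType.Exports.

Local Open Scope classical_set_scope.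
Local Open Scope ring_scope.

(* Points of R^n are row vectors; R^m x R^n is identified with R^(m + n)
   through row_mx. *)

Definition algebraic_set (R : realType) (n : nat) (X : set 'rV[R]_n) : Prop :=
  exists s : seq (mpoly n R),
    X = [set x | forall p, p \in s ->
                   meval (fun i => x ord0 i) p = 0].

Record o_minimal (R : realType) (D : forall n, set (set 'rV[R]_n)) : Prop := {
  o_minimal0 : forall n, D n set0;
  o_minimalC : forall n X, D n X -> D n (~` X);
  o_minimalU : forall n X Y, D n X -> D n Y -> D n (X `|` Y);
  o_minimalX : forall m n X Y, D m X -> D n Y ->
    D (m + n)%N [set row_mx x y | x in X & y in Y];
  o_minimal_proj : forall n (X : set 'rV[R]_(n + 1)),
    D (n + 1)%N X -> D n [set lsubmx x | x in X];
  o_minimal_algebraic : forall n X, algebraic_set X -> D n X;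
  (* A term of type interval R denotes a point, or an interval, bounded or
     not, with each endpoint included or excluded. *)
  o_minimal_tame : forall X, D 1%N X ->
    exists s : seq (interval R),
      X = [set x | exists2 i, i \in s & x ord0 ord0 \in i] }.

Definition definable_map (R : realType) (D : forall n, set (set 'rV[R]_n))
    (m n : nat) (f : 'rV[R]_m -> 'rV[R]_n) : Prop :=
  D (m + n)%N [set row_mx x (f x) | x in setT].

(* The library norm on matrices is the sup norm. *)
Definition enorm (R : realType) (n : nat) (v : 'rV[R]_n) : R :=
  Num.sqrt (\sum_(i < n) v ord0 i ^+ 2).

Definition eball (R : realType) (n : nat) (x : 'rV[R]_n) (r : R) :
    set 'rV[R]_n :=
  [set y | enorm (y - x) < r].

Definition convex_hull (R : realType) (M : lmodType R) (S : set M) : set M :=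
  smallest (fun A : set M => convex_set A) S.

(* As for 'J f x, a square matrix A stands for the linear map v |-> v *m A of
   row vectors, so v *m A is the image of v. *)
Definition sigma (R : realType) (n : nat) (A : 'M[R]_n) : \bar R :=
  ereal_inf [set (enorm (v *m A))%:E | v in [set v : 'rV[R]_n | enorm v = 1]].

Definition C1_at (R : realType) (m n : nat) (f : 'rV[R]_m -> 'rV[R]_n)
    (x : 'rV[R]_m) : Prop :=
  \forall y \near x, differentiable f y /\ {for y, continuous (jacobian f)}.

(* The set written B_f. *)
Definition non_C1 (R : realType) (m n : nat) (f : 'rV[R]_m -> 'rV[R]_n) :
    set 'rV[R]_m :=
  [set x | ~ C1_at f x].

Definition jacobians (R : realType) (n : nat) (f : 'rV[R]_n -> 'rV[R]_n)
    (U : set 'rV[R]_n) : set 'M[R]_n :=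
  [set jacobian f x | x in U `\` non_C1 f].

(* The limit exists since the infimum is nonincreasing in r. *)
Definition nu (R : realType) (n : nat) (f : 'rV[R]_n -> 'rV[R]_n)
    (x : 'rV[R]_n) : \bar R :=
  lim (ereal_inf [set sigma A | A in convex_hull (jacobians f (eball x r))]
       @[r --> 0^'+]).

(* Riemann sum of f on [a, b] for the partition a :: s, where t i is the tag
   of the i-th subinterval. *)
Definition riemann_sum (R : realType) (f : R -> R) (a b : R) (s : seq R)
    (t : nat -> R) : R :=
  let x := nth b (a :: s) in
  \sum_(0 <= i < size s) f (t i) * (x i.+1 - x i).

Definition is_riemann_integral (R : realType) (f : R -> R) (a b I : R) : Prop :=
  forall e, 0 < e -> exists2 d, 0 < d &
    forall (s : seq R) (t : nat -> R), itv_partition a b s ->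
      (forall i, (i < size s)%N ->
         let x := nth b (a :: s) in
         x i <= t i <= x i.+1 /\ x i.+1 - x i < d) ->
      `|riemann_sum f a b s t - I| < e.

Definition riemann_integrable (R : realType) (f : R -> R) (a b : R) : Prop :=
  exists I, is_riemann_integral f a b I.

Definition riemann_integral (R : realType) (f : R -> R) (a b : R) : R :=
  get (is_riemann_integral f a b).

Definition homeomorphism (T U : topologicalType) (f : T -> U) : Prop :=
  continuous f /\
  exists g : U -> T, [/\ continuous g, cancel f g & cancel g f].

(* Main.v *)
Require Import Defs.
From HB Require Import structures.
From mathcomp Require Import all_boot all_order all_algebra.
From mathcomp Require Import all_classical all_reals all_analysis.
From mathcomp Require Import -(notations) mpoly.
From mathcomp Require Import ring lra.

Set Implicit Arguments.
Unset Strict Implicit.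
Unset Printing Implicit Defensive.

Import Order.TTheory GRing.Theory Num.Theory.
Import numFieldNormedType.Exports.

Local Open Scope classical_set_scope.
Local Open Scope ring_scope.

(* A definable set or its complement has interior in every ball, by induction on
   the dimension and Baire's theorem; applied to the sets where a difference
   quotient of f eventually exceeds a rational, this makes f of class C^1 off a
   closed definable nowhere dense set. A generic line meets that set in no
   interval, so the mean value inequality holds along all segments although df may
   be unbounded. Separating 0 from the convex sets { v A : A in co (df (B)) } and
   { e A^T : A in co (df (B)) } shows that f expands distances on B by at least
   k < c, and that for every e some direction moves f along e at speed at least k.
   Smoothing f by averages preserves these bounds and makes f Lipschitz, so that
   a nonzero minimum of |f - q| could be decreased: f covers a ball without using
   invariance of domain. Finally lifts of the segments issued from f 0 stay
   bounded, because crossing an annulus r <= |x| <= s takes at least the time given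
   by a lower Darboux sum of c, whose integral diverges. Hence the local inverses
   glue to a continuous section of f over every ball around f 0, and f has a
   continuous inverse. *)

(** * Euclidean norm on row vectors *)

(** As [df] may be unbounded, its limits at a point need not form a compact set, and the inverse
    function theorem for Lipschitz maps is out of reach. The remedy is to work with bounds
    [al <= dot (f (y + v) - f y) w] in which [w] does not depend on [y]. Such a bound is linear in
    [f]: it follows from separation in a single direction, and it survives averaging over
    translates, which a lower bound on norms does not. Two families are needed, since expansion
    gives local injectivity but says nothing of openness; the second family comes from transposes,
    which have the same smallest singular value. The Lipschitz constants of the averages may blow up
    as the averages approach [f], but the radius that is covered depends only on the rate [k] and on
    the size of the ball, so covering passes to the limit. The continuation takes place over a whole
    ball of targets, dilated step by step, rather than along each segment separately: continuity of
    the lift in its endpoint then comes with each step. *)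

Definition dot (R : realType) n (u v : 'rV[R]_n) : R :=
  \sum_(i < n) u ord0 i * v ord0 i.

Section Euclidean.
Variables (R : realType) (n : nat).
Implicit Types u v w x y : 'rV[R]_n.

Lemma dotC u v : dot u v = dot v u.
Proof. by apply: eq_bigr => i _; rewrite mulrC. Qed.

Lemma dotDl u v w : dot (u + v) w = dot u w + dot v w.
Proof. by rewrite -big_split; apply: eq_bigr => i _; rewrite mxE mulrDl. Qed.

Lemma dotZl a u w : dot (a *: u) w = a * dot u w.
Proof. by rewrite mulr_sumr; apply: eq_bigr => i _; rewrite mxE mulrA. Qed.

Lemma dotNl u w : dot (- u) w = - dot u w.
Proof. by rewrite -scaleN1r dotZl mulN1r. Qed.

Lemma dotBl u v w : dot (u - v) w = dot u w - dot v w.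
Proof. by rewrite dotDl dotNl. Qed.

Lemma dotDr u v w : dot w (u + v) = dot w u + dot w v.
Proof. by rewrite dotC dotDl !(dotC w). Qed.

Lemma dotZr a u w : dot w (a *: u) = a * dot w u.
Proof. by rewrite dotC dotZl (dotC w). Qed.

Lemma dotBr u v w : dot w (u - v) = dot w u - dot w v.
Proof. by rewrite dotC dotBl !(dotC w). Qed.

Lemma dot0l w : dot 0 w = 0.
Proof. by rewrite -(scale0r 0) dotZl mul0r. Qed.

Lemma dot_ge0 u : 0 <= dot u u.
Proof. by apply: sumr_ge0 => i _; rewrite -expr2 sqr_ge0. Qed.

Lemma enormE u : enorm u = Num.sqrt (dot u u).
Proof. by congr Num.sqrt; apply: eq_bigr => i _; rewrite expr2. Qed.

Lemma enorm_ge0 u : 0 <= enorm u.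
Proof. by rewrite sqrtr_ge0. Qed.

Lemma dot_self u : dot u u = enorm u ^+ 2.
Proof. by rewrite enormE sqr_sqrtr ?dot_ge0. Qed.

Lemma coord_le_enorm u i : `|u ord0 i| <= enorm u.
Proof.
rewrite -(@ler_pXn2r _ 2)// ?nnegrE ?normr_ge0 ?enorm_ge0//.
rewrite real_normK ?num_real// -dot_self /dot (bigD1 i)//= -expr2 lerDl.
by apply: sumr_ge0 => j _; rewrite -expr2 sqr_ge0.
Qed.

Lemma enorm_eq0 u : (enorm u == 0) = (u == 0).
Proof.
apply/eqP/eqP => [u0|->]; last by rewrite enormE dot0l sqrtr0.
apply/rowP => i; rewrite mxE; apply/eqP; rewrite -normr_le0 -u0.
exact: coord_le_enorm.
Qed.

Lemma enorm0 : enorm (0 : 'rV[R]_n) = 0.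
Proof. by apply/eqP; rewrite enorm_eq0. Qed.

Lemma enorm_gt0 u : (0 < enorm u) = (u != 0).
Proof. by rewrite lt_def enorm_eq0 enorm_ge0 andbT. Qed.

Lemma enormZ a u : enorm (a *: u) = `|a| * enorm u.
Proof.
by rewrite !enormE dotZl dotZr mulrA -expr2 sqrtrM ?sqr_ge0// sqrtr_sqr.
Qed.

Lemma enormN u : enorm (- u) = enorm u.
Proof. by rewrite -scaleN1r enormZ normrN1 mul1r. Qed.

Lemma enormC u v : enorm (u - v) = enorm (v - u).
Proof. by rewrite -enormN opprB. Qed.

Lemma dot_le u v : dot u v <= enorm u * enorm v.
Proof.
have [->|v0] := eqVneq v 0; first by rewrite dotC dot0l enorm0 mulr0.
have := dot_ge0 (enorm v *: u - enorm u *: v).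
rewrite dotBl !dotBr !dotZl !dotZr !dot_self (dotC v u) => H.
have [->|u0] := eqVneq u 0; first by rewrite dot0l enorm0 mul0r.
move: H; rewrite -enorm_gt0 in v0; rewrite -enorm_gt0 in u0.
set a := enorm u in u0 *; set b := enorm v in v0 *; set d := dot u v => H.
have : 0 <= (a * b) * (a * b - d) by nra.
by rewrite pmulr_rge0 ?mulr_gt0// subr_ge0.
Qed.

Lemma enormD u v : enorm (u + v) <= enorm u + enorm v.
Proof.
rewrite -(@ler_pXn2r _ 2)// ?nnegrE ?addr_ge0 ?enorm_ge0//.
rewrite -dot_self dotDl !dotDr !dot_self (dotC v u).
by have := dot_le u v; nra.
Qed.

Lemma enormB_le x y z : enorm (x - z) <= enorm (x - y) + enorm (y - z).
Proof. by rewrite (le_trans _ (enormD _ _))// addrA subrK. Qed.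

Lemma enorm_dist u v : `|enorm u - enorm v| <= enorm (u - v).
Proof.
rewrite ler_norml; apply/andP; split.
  by have := enormB_le v u 0; rewrite !subr0 enormC; lra.
by have := enormB_le u v 0; rewrite !subr0; lra.
Qed.

Lemma enorm_le_sum u : enorm u <= \sum_(i < n) `|u ord0 i|.
Proof.
have S0 : 0 <= \sum_(i < n) `|u ord0 i| by apply: sumr_ge0.
rewrite -(@ler_pXn2r _ 2)// ?nnegrE ?enorm_ge0// -dot_self [leRHS]expr2 mulr_suml.
apply: ler_sum => i _; apply: le_trans (ler_norm _) _; rewrite normrM.
apply: ler_wpM2l => //; rewrite (bigD1 i)//= lerDl; exact: sumr_ge0.
Qed.

Lemma enorm_lt_cube u d : 0 < d -> (forall i, `|u ord0 i| < d / n.+1%:R) ->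
  enorm u < d.
Proof.
move=> d0 ud; apply: le_lt_trans (enorm_le_sum u) _.
apply: (@le_lt_trans _ _ (\sum_(i < n) (d / n.+1%:R))).
  by apply: ler_sum => i _; exact: ltW.
rewrite sumr_const card_ord -[ltLHS]mulr_natr mulrAC ltr_pdivrMr ?ltr0n//.
by rewrite ltr_pM2l// ltr_nat.
Qed.

(** Cubes are the neighborhoods that turn into polynomial inequalities, hence into definable
    formulas; Euclidean balls suit the bounds on [f]. *)
Lemma nbhs_cubeP x (A : set 'rV[R]_n) : nbhs x A <->
  exists2 e : R, 0 < e & forall y, (forall i, `|y ord0 i - x ord0 i| < e) -> A y.
Proof.
split.
  move=> /nbhs_ballP[e /= e0 xeA]; exists e => // y xy; apply: xeA.
  split => // i j; rewrite ord1 /ball /= distrC; exact: xy.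
move=> [e e0 H]; apply/nbhs_ballP; exists e => //= y [_ xy]; apply: H => i.
by rewrite distrC; exact: xy.
Qed.

Lemma nbhs_eballP x (A : set 'rV[R]_n) : nbhs x A <->
  exists2 e : R, 0 < e & eball x e `<=` A.
Proof.
split=> [/nbhs_cubeP[e e0 H]|[e e0 H]].
  exists e => // y xy; apply: H => i.
  by have := coord_le_enorm (y - x) i; rewrite !mxE => /le_lt_trans; exact.
apply/nbhs_cubeP; exists (e / n.+1%:R); first by rewrite divr_gt0 ?ltr0n.
move=> y xy; apply: H; apply: enorm_lt_cube => // i; rewrite !mxE; exact: xy.
Qed.

Lemma nbhs_eball x e : 0 < e -> nbhs x (eball x e).
Proof. by move=> e0; apply/nbhs_eballP; exists e. Qed.

Lemma open_eball x e : open (eball x e).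
Proof.
rewrite openE => y xy; apply/nbhs_eballP; exists (e - enorm (y - x)).
  by rewrite subr_gt0.
move=> z; rewrite /eball /=; have := enormB_le z y x; lra.
Qed.

Lemma cvg_eballP (g : 'rV[R]_n -> R) x : {for x, continuous g} <->
  forall e : R, 0 < e -> exists2 d : R, 0 < d &
    forall y, enorm (y - x) < d -> `|g y - g x| < e.
Proof.
split=> [gx e e0|H].
  have /nbhs_eballP[d d0 xd] : nbhs x [set y | `|g y - g x| < e].
    have /(@cvgrPdist_lt R R^o _ (nbhs x)) /(_ e e0) := gx.
    by apply: filterS => y; rewrite distrC.
  by exists d => // y; exact: xd.
apply/(@cvgrPdist_lt R R^o _ (nbhs x)) => e /H[d d0 xd].
by apply/nbhs_eballP; exists d => // y /xd; rewrite /= distrC.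
Qed.

Lemma enorm_continuous : continuous (@enorm R n).
Proof.
move=> x; apply/cvg_eballP => e e0; exists e => // y xy.
by apply: le_lt_trans xy; exact: enorm_dist.
Qed.

Lemma dotl_continuous w : continuous (fun u => dot u w).
Proof.
move=> x; apply/cvg_eballP => e e0.
have w0 : 0 < enorm w + 1 by rewrite ltr_wpDl ?enorm_ge0.
exists (e / (enorm w + 1)); first exact: divr_gt0.
move=> y; rewrite ltr_pdivlMr// -dotBl => xy.
rewrite ltr_norml; apply/andP; split.
  rewrite ltrNl -dotNl; apply: le_lt_trans (dot_le _ _) _; rewrite enormN.
  by have := enorm_ge0 (y - x); have := enorm_ge0 w; nra.
apply: le_lt_trans (dot_le _ _) _.
by have := enorm_ge0 (y - x); have := enorm_ge0 w; nra.
Qed.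

Lemma compact_closed_eball x r : compact [set y | enorm (y - x) <= r].
Proof.
apply: bounded_closed_compact.
  exists (r + enorm x); split; first exact: num_real.
  move=> M rM y /= xy; apply: le_trans (ltW rM).
  have yr : enorm y <= r + enorm x.
    by have := enormB_le y x 0; rewrite !subr0; lra.
  rewrite /Num.norm/= mx_normrE; apply/bigmax_leP; split => /=.
    exact: le_trans (enorm_ge0 _) yr.
  by move=> [i j] _ /=; rewrite ord1; apply: le_trans yr; exact: coord_le_enorm.
rewrite -(setCK [set y | _]); apply: open_closedC; rewrite openE => y /= /negP.
rewrite -ltNge => xy; apply/nbhs_eballP; exists (enorm (y - x) - r).
  by rewrite subr_gt0.
move=> z; rewrite /eball /= (enormC z y) => zy; apply/negP; rewrite -ltNge.
by have := enormB_le y z x; lra.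
Qed.

End Euclidean.

Lemma enorm_cvgP (R : realType) n (T : Type) (F : set_system T) (FF : Filter F)
    (f : T -> 'rV[R]_n) (l : 'rV[R]_n) :
  f @ F --> l <-> forall e : R, 0 < e -> \forall t \near F, enorm (f t - l) < e.
Proof.
split=> [fl e e0|H A /nbhs_eballP[e e0 lA]].
  exact: fl _ (nbhs_eball l e0).
by apply: filterS (H e e0) => t; exact: lA.
Qed.

Lemma cvg_realP (R : realType) (g : R -> R) x : {for x, continuous g} <->
  forall e : R, 0 < e -> exists2 d : R, 0 < d &
    forall y, `|y - x| < d -> `|g y - g x| < e.
Proof.
split=> [gx e e0|H].
  have /nbhs_ballP[d d0 xd] : nbhs x [set y | `|g y - g x| < e].
    have /(@cvgrPdist_lt R R^o _ (nbhs x)) /(_ e e0) := gx.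
    by apply: filterS => y; rewrite distrC.
  by exists d => // y xy; apply: xd; rewrite /ball/= distrC.
apply/(@cvgrPdist_lt R R^o _ (nbhs x)) => e /H[d d0 xd].
apply/nbhs_ballP; exists d => // y; rewrite /ball/= distrC => /xd.
by rewrite distrC.
Qed.

(** * Definable sets *)

Section Definable.
Variables (R : realType) (D : forall n, set (set 'rV[R]_n)).
Arguments D : clear implicits.
Hypothesis hD : o_minimal D.

Definition polyfun n (g : 'rV[R]_n -> R) :=
  exists p : mpoly n R, forall x, g x = meval (fun i => x ord0 i) p.

Definition polymap m n (t : 'rV[R]_m -> 'rV[R]_n) :=
  forall i, polyfun (fun x => t x ord0 i).

Lemma polyfun_cst n c : polyfun (fun _ : 'rV[R]_n => c).
Proof. by exists (mpolyC n c) => x; rewrite mevalC. Qed.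

Lemma polyfunD n (g h : 'rV[R]_n -> R) :
  polyfun g -> polyfun h -> polyfun (fun x => g x + h x).
Proof. by move=> [p gp] [q hq]; exists (p + q) => x; rewrite mevalD gp hq. Qed.

Lemma polyfunB n (g h : 'rV[R]_n -> R) :
  polyfun g -> polyfun h -> polyfun (fun x => g x - h x).
Proof. by move=> [p gp] [q hq]; exists (p - q) => x; rewrite mevalB gp hq. Qed.

Lemma polyfunM n (g h : 'rV[R]_n -> R) :
  polyfun g -> polyfun h -> polyfun (fun x => g x * h x).
Proof. by move=> [p gp] [q hq]; exists (p * q) => x; rewrite mevalM gp hq. Qed.

Lemma polymap_id n : polymap (@id 'rV[R]_n).
Proof. by move=> i; exists (mpolyX R (mnm1 i)) => x; rewrite mevalXU. Qed.

Lemma polyfun_comp m n (t : 'rV[R]_m -> 'rV[R]_n) g :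
  polymap t -> polyfun g -> polyfun (fun x => g (t x)).
Proof.
move=> tp [p gp].
have /choice[q qE] := tp.
exists (comp_mpoly (mktuple q) p) => x; rewrite gp comp_mpoly_meval.
by apply: meval_eq => i; rewrite tnth_mktuple qE.
Qed.

Lemma polymap_comp m n k (t : 'rV[R]_m -> 'rV[R]_n) (u : 'rV[R]_n -> 'rV[R]_k) :
  polymap t -> polymap u -> polymap (fun x => u (t x)).
Proof. by move=> tp up i; exact: polyfun_comp tp (up i). Qed.

Lemma polymap_lsub m n k (t : 'rV[R]_m -> 'rV[R]_(n + k)) :
  polymap t -> polymap (fun x => lsubmx (t x)).
Proof.
move=> tp i; have [p pE] := tp (lshift k i).
by exists p => x; rewrite -pE mxE.
Qed.

Lemma polymap_rsub m n k (t : 'rV[R]_m -> 'rV[R]_(n + k)) :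
  polymap t -> polymap (fun x => rsubmx (t x)).
Proof.
move=> tp i; have [p pE] := tp (rshift n i).
by exists p => x; rewrite -pE mxE.
Qed.

Lemma polymapD m n (t u : 'rV[R]_m -> 'rV[R]_n) :
  polymap t -> polymap u -> polymap (fun x => t x + u x).
Proof.
move=> tp up i; have [p pE] := polyfunD (tp i) (up i).
by exists p => x; rewrite -pE mxE.
Qed.

Lemma polymapZ m n (g : 'rV[R]_m -> R) (u : 'rV[R]_m -> 'rV[R]_n) :
  polyfun g -> polymap u -> polymap (fun x => g x *: u x).
Proof.
move=> tp up i; have [p pE] := polyfunM tp (up i).
by exists p => x; rewrite -pE mxE.
Qed.

Lemma polymap_cst m n v : polymap (fun _ : 'rV[R]_m => v : 'rV[R]_n).
Proof. by move=> i; exact: polyfun_cst. Qed.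

Lemma polymap_row m n k (t : 'rV[R]_m -> 'rV[R]_n) (u : 'rV[R]_m -> 'rV[R]_k) :
  polymap t -> polymap u -> polymap (fun x => row_mx (t x) (u x)).
Proof.
move=> tp up i; case: (split_ordP i) => j ->.
  by have [p pE] := tp j; exists p => x; rewrite -pE row_mxEl.
by have [p pE] := up j; exists p => x; rewrite -pE row_mxEr.
Qed.

Lemma definable_eq0 n g : polyfun g -> D n [set x | g x = 0].
Proof.
move=> [p gp]; apply: (o_minimal_algebraic hD); exists [:: p].
apply/seteqP; split => x /=.
  by move=> gx q; rewrite mem_seq1 => /eqP ->; rewrite -gp.
by move=> /(_ p); rewrite mem_seq1 eqxx -gp; exact.
Qed.

Lemma definableC n (P : 'rV[R]_n -> Prop) :
  D n [set x | P x] -> D n [set x | ~ P x].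
Proof. by move=> /(o_minimalC hD). Qed.

Lemma definableU n (P Q : 'rV[R]_n -> Prop) :
  D n [set x | P x] -> D n [set x | Q x] -> D n [set x | P x \/ Q x].
Proof. exact: (o_minimalU hD). Qed.

Lemma definableI n (P Q : 'rV[R]_n -> Prop) :
  D n [set x | P x] -> D n [set x | Q x] -> D n [set x | P x /\ Q x].
Proof.
move=> dP dQ; have := definableC (definableU (definableC dP) (definableC dQ)).
congr D; apply/seteqP; split => x /=.
  by move=> /not_orP[/contrapT ? /contrapT ?].
by move=> [? ?] [|].
Qed.

Lemma definable_imp n (P Q : 'rV[R]_n -> Prop) :
  D n [set x | P x] -> D n [set x | Q x] -> D n [set x | P x -> Q x].
Proof.
move=> dP dQ; have := definableU (definableC dP) dQ.
congr D; apply/seteqP; split => x /=; first by case.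
by move=> PQ; have [/PQ|] := pselect (P x); [right|left].
Qed.

Lemma definableT n : D n setT.
Proof. by rewrite -setC0; exact: (o_minimalC hD (o_minimal0 hD _)). Qed.

Lemma definable_forall_fin n m (P : 'I_m -> 'rV[R]_n -> Prop) :
  (forall i, D n [set x | P i x]) -> D n [set x | forall i, P i x].
Proof.
elim: m P => [|m IH] P dP.
  by have := definableT n; congr D; apply/seteqP; split => x //= _ [].
have := definableI (dP ord0) (IH (fun i => P (lift ord0 i)) (fun i => dP _)).
congr D; apply/seteqP; split => x /=.
  by move=> [P0 PS] i; case: (unliftP ord0 i) => [j|] ->.
by move=> Px; split.
Qed.

(** The axiom projects away one coordinate, so a block of [m] coordinates is eliminated one at a
    time; [n + (m + 1)] and [n + m + 1] are not convertible, hence the casts. *)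
Lemma definable_ex n m (P : 'rV[R]_n -> 'rV[R]_m -> Prop) :
  D (n + m) [set z | P (lsubmx z) (rsubmx z)] -> D n [set x | exists v, P x v].
Proof.
elim: m P => [|m IH] P.
  suff e : (fun z : 'rV[R]_(n + 0) => P (lsubmx z) (rsubmx z)) =
      (fun z : 'rV[R]_(n + 0) => exists v, P (lsubmx z) v).
    rewrite /mkset e => {e}.
    suff e : forall (k : nat) (e : k = n) (Q : 'rV[R]_n -> Prop),
        D k (fun z => Q (castmx (erefl, e) z)) -> D n Q.
      move=> H; apply: (e _ (addn0 n)); move: H; congr D; apply/funext => z.
      rewrite (_ : lsubmx z = castmx (erefl, addn0 n) z)//; apply/rowP => i.
      by rewrite mxE castmxE /= cast_ord_id; congr (z _ _); exact: val_inj.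
    by move=> k e; case: _ / e.
  apply/funext => z; apply/propext; split; first by exists (rsubmx z).
  by move=> [v]; rewrite (_ : v = rsubmx z)//; apply/rowP => -[].
move: P; rewrite -[m.+1]addn1 => P dP.
have /(IH (fun x v => exists t, P x (row_mx v t))) : D (n + m) [set z | exists t : 'rV[R]_1,
    P (lsubmx z) (row_mx (rsubmx z) t)].
  have tr : forall k (e : (n + (m + 1))%N = k),
      D k (fun z => P (lsubmx (castmx (erefl, esym e) z))
                      (rsubmx (castmx (erefl, esym e) z))).
    by move=> k; case: _ /; exact: dP.
  have /(o_minimal_proj hD) := tr _ (addnA n m 1%N).
  have trE (z : 'rV[R]_(n + m)) (t : 'rV[R]_1) :
      castmx (erefl, esym (addnA n m 1%N)) (row_mx z t) =
      row_mx (lsubmx z) (row_mx (rsubmx z) t).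
    by rewrite row_mxA hsubmxK; congr castmx; congr pair; exact: eq_irrelevance.
  congr D; apply/seteqP; split => x /=.
    move=> [z Pz <-]; exists (rsubmx z); move: Pz; rewrite -{1 2}(hsubmxK z) trE.
    by rewrite row_mxKl row_mxKr.
  move=> [t Pt]; exists (row_mx x t); last by rewrite row_mxKl.
  by rewrite /mkset trE row_mxKl row_mxKr.
congr D; apply/seteqP; split => x /=.
  by move=> [v [t Pt]]; exists (row_mx v t).
by move=> [v Pv]; exists (lsubmx v), (rsubmx v); rewrite hsubmxK.
Qed.

(** The graph of [t] is algebraic; the preimage is the projection of its intersection with the
    product of the whole space and [P]. *)
Lemma definable_subst m n (t : 'rV[R]_m -> 'rV[R]_n) (P : 'rV[R]_n -> Prop) :
  polymap t -> D n [set x | P x] -> D m [set x | P (t x)].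
Proof.
move=> tp dP.
have := @definable_ex m n (fun x y => (forall i, t x ord0 i - y ord0 i = 0) /\ P y).
have -> : [set x | exists v : 'rV[R]_n, (forall i, t x ord0 i - v ord0 i = 0) /\ P v] =
   [set x | P (t x)].
  apply/seteqP; split => x /=.
    move=> [y [ty]]; rewrite (_ : t x = y)//.
    by apply/rowP => i; apply/eqP; rewrite -subr_eq0 ty.
  by move=> Px; exists (t x); split=> // i; rewrite subrr.
apply; apply: definableI.
  apply: definable_forall_fin => i; apply: definable_eq0; apply: polyfunB.
    exact: polyfun_comp (polymap_lsub (@polymap_id _)) (tp i).
  exact: (polymap_rsub (@polymap_id _)).
have := o_minimalX hD (definableT m) dP; congr D.
apply/seteqP; split => z /=.
  by move=> [x _ [y Py <-]]; rewrite row_mxKr.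
by move=> Pz; exists (lsubmx z) => //; exists (rsubmx z) => //; rewrite hsubmxK.
Qed.

Lemma definable_all n m (P : 'rV[R]_n -> 'rV[R]_m -> Prop) :
  D (n + m) [set z | P (lsubmx z) (rsubmx z)] -> D n [set x | forall v, P x v].
Proof.
move=> dP.
have := definableC (@definable_ex n m (fun x v => ~ P x v) (definableC dP)).
congr D; apply/seteqP; split => x /=.
  by move=> nP v; apply: contrapT => nPv; apply: nP; exists v.
by move=> Px [v]; exact.
Qed.

Lemma definable_ex1 n (P : 'rV[R]_n -> R -> Prop) :
  D (n + 1) [set z | P (lsubmx z) (rsubmx z ord0 ord0)] ->
  D n [set x | exists v, P x v].
Proof.
move=> /(@definable_ex n 1 (fun x v => P x (v ord0 ord0))).
congr D; apply/seteqP; split => x /= [v Pv]; first by exists (v ord0 ord0).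
by exists (const_mx v); rewrite mxE.
Qed.

Lemma definable_all1 n (P : 'rV[R]_n -> R -> Prop) :
  D (n + 1) [set z | P (lsubmx z) (rsubmx z ord0 ord0)] ->
  D n [set x | forall v, P x v].
Proof.
move=> /(@definable_all n 1 (fun x v => P x (v ord0 ord0))).
congr D; apply/seteqP; split => x /= Px v; last exact: Px.
by have := Px (const_mx v); rewrite mxE.
Qed.

(* [0 < g x] iff [g x * t ^ 2 = 1] is solvable in [t]. *)
Lemma definable_gt0 n g : polyfun g -> D n [set x | 0 < g x].
Proof.
move=> gp; have := @definable_ex1 n (fun x t => g x * (t * t) - 1 = 0).
have -> : [set x | exists t, g x * (t * t) - 1 = 0] = [set x | 0 < g x].
  apply/seteqP; split => x /=.
    move=> [t /eqP]; rewrite subr_eq0 => /eqP gt1.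
    rewrite ltNge; apply/negP => g0.
    have : g x * (t * t) <= 0 by rewrite mulr_le0_ge0 // -expr2 sqr_ge0.
    by rewrite gt1 ler10.
  move=> g0; exists (Num.sqrt (g x)^-1).
  by rewrite -expr2 sqr_sqrtr ?invr_ge0 ?ltW// mulfV ?subrr// gt_eqF.
apply; apply: definable_eq0; apply: polyfunB; last exact: polyfun_cst.
apply: polyfunM; first exact: polyfun_comp (polymap_lsub (@polymap_id _)) gp.
by apply: polyfunM; exact: (polymap_rsub (@polymap_id _)).
Qed.

Lemma definable_lt n g h :
  polyfun g -> polyfun h -> D n [set x | g x < h x].
Proof.
move=> gp hp; have := definable_gt0 (polyfunB hp gp); congr D.
by apply/seteqP; split => x /=; rewrite subr_gt0.
Qed.

Lemma definable_le n g h :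
  polyfun g -> polyfun h -> D n [set x | g x <= h x].
Proof.
move=> gp hp; have := definableC (definable_lt hp gp); congr D.
by apply/seteqP; split => x /=; rewrite leNgt => /negP.
Qed.

(** The value [f (t x)] becomes a quantified variable confined to the graph of [f]. Every formula
    that mentions [f] is built in this way. *)
Lemma definable_app m n k (f : 'rV[R]_m -> 'rV[R]_k) (t : 'rV[R]_n -> 'rV[R]_m)
    (P : 'rV[R]_n -> 'rV[R]_k -> Prop) :
  definable_map D f -> polymap t ->
  D (n + k) [set z | P (lsubmx z) (rsubmx z)] -> D n [set x | P x (f (t x))].
Proof.
move=> fd tp dP.
have := @definable_ex n k
  (fun x v => [set row_mx x (f x) | x in setT] (row_mx (t x) v) /\ P x v).
have -> : [set x | exists v : 'rV[R]_k,
    [set row_mx x (f x) | x in setT] (row_mx (t x) v) /\ P x v] =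
    [set x | P x (f (t x))].
  apply/seteqP; split => x /=.
    by move=> [v [[y _ /eq_row_mx[-> ->]]]].
  by move=> Px; exists (f (t x)); split => //; exists (t x).
apply; apply: definableI dP; apply: definable_subst fd.
apply: polymap_row; last exact: polymap_rsub (@polymap_id _).
exact: polymap_comp (polymap_lsub (@polymap_id _)) tp.
Qed.

End Definable.

(** * Real induction, germs of definable sets and Baire category *)

(** The supremum of the points of [[a, b]] where [P] holds satisfies [P] by the closure hypothesis,
    and the extension hypothesis prevents it from being less than [b]. *)
Lemma real_induction (R : realType) (P : R -> Prop) (a b : R) : a <= b -> P a ->
  (forall t, a <= t <= b ->
     (forall d, 0 < d -> exists s, [/\ a <= s <= b, t - d < s <= t & P s]) -> P t) ->
  (forall t, a <= t < b -> P t -> exists s, t < s <= b /\ P s) ->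
  P b.
Proof.
move=> ab Pa Pclosed Pright.
pose E := [set t | a <= t <= b /\ P t].
have Ea : E a by split; rewrite ?lexx ?ab.
have ubE : ubound E b by move=> t [/andP[]].
have supE : has_sup E by split; [exists a|exists b].
set c := sup E.
have ac : a <= c by apply: ub_le_sup => //; exists b.
have cb : c <= b by apply: ge_sup => //; exists a.
have Pc : P c.
  apply: Pclosed; first by rewrite ac.
  move=> d d0; have [t Et ct] := sup_adherent d0 supE.
  exists t; split; [by case: Et| |by case: Et].
  by rewrite ct /=; apply: ub_le_sup => //; exists b.
have [cltb|bc] := ltP c b; last by have <- : c = b by lra.
have [s [/andP[cs sb] Ps]] := Pright c (introT andP (conj ac cltb)) Pc.
have : s <= c.
  by apply: ub_le_sup; [exists b|split => //; rewrite sb (le_trans ac (ltW cs))].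
by rewrite leNgt cs.
Qed.

Lemma right_increasing (R : realType) (phi : R -> R) (a b : R) : a <= b ->
  (forall t, a <= t <= b -> {for t, continuous phi}) ->
  (forall t, a <= t < b -> exists2 d : R, 0 < d &
     forall s, t < s < t + d -> phi t <= phi s) ->
  phi a <= phi b.
Proof.
move=> ab cphi lphi.
apply: (@real_induction R (fun t => phi a <= phi t) a b) => //.
  move=> t /cphi/cvg_realP cphit H; rewrite leNgt; apply/negP => ta.
  have /cphit[d d0 td] : 0 < phi a - phi t by rewrite subr_gt0.
  have [s [_ /andP[ts st] as_]] := H d d0.
  have /td : `|s - t| < d by rewrite ler0_norm ?subr_le0//; lra.
  by rewrite ltr_norml => /andP[_ ?]; lra.
move=> t tab phit; have /andP[_ tb] := tab; have [d d0 td] := lphi t tab.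
have m0 : 0 < Num.min d (b - t) by rewrite lt_min d0 subr_gt0.
have m1 : Num.min d (b - t) <= d by rewrite ge_min lexx.
have m2 : Num.min d (b - t) <= b - t by rewrite ge_min lexx orbT.
exists (t + Num.min d (b - t) / 2); split; first by apply/andP; split; lra.
by apply: le_trans phit (td _ _); apply/andP; split; lra.
Qed.

Lemma itv_germ (R : realType) (i : interval R) (a : R) :
  exists2 d : R, 0 < d & (forall t, a < t < a + d -> t \in i) \/
                     (forall t, a < t < a + d -> t \notin i).
Proof.
have bnd (b : itv_bound R) : exists2 d : R, 0 < d &
    (forall t, a < t < a + d -> (b <= BLeft t)%O) \/
    (forall t, a < t < a + d -> ~~ (b <= BLeft t)%O).
  case: b => [sd c|[]]; [|by exists 1 => //; left|by exists 1 => //; right].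
  have [ca|ac] := leP c a.
    exists 1 => //; left => t /andP[at_ _].
    by case: sd; rewrite bnd_simp ?(le_lt_trans ca)// ltW// (le_lt_trans ca).
  exists (c - a); first by rewrite subr_gt0.
  right => t /andP[_]; rewrite addrC subrK => tc.
  by case: sd; rewrite bnd_simp -?ltNge -?leNgt// ltW.
case: i => l u.
have [d d0 ld] := bnd l.
have bndu : exists2 d : R, 0 < d &
    (forall t, a < t < a + d -> (BRight t <= u)%O) \/
    (forall t, a < t < a + d -> ~~ (BRight t <= u)%O).
  case: u => [sd c|[]]; [|by exists 1 => //; right|by exists 1 => //; left].
  have [ca|ac] := leP c a.
    exists 1 => //; right => t /andP[at_ _].
    by case: sd; rewrite bnd_simp -?ltNge -?leNgt ?(le_lt_trans ca)// ltW// (le_lt_trans ca).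
  exists (c - a); first by rewrite subr_gt0.
  left => t /andP[_]; rewrite addrC subrK => tc.
  by case: sd; rewrite bnd_simp ?ltW.
have [e e0 ue] := bndu.
exists (Num.min d e); first by rewrite lt_min d0.
have mind t : a < t < a + Num.min d e -> a < t < a + d /\ a < t < a + e.
  move=> /andP[-> /= tde].
  by split; apply: lt_le_trans tde _; rewrite lerD2l ge_min lexx ?orbT.
case: ld => [ld|ld]; last first.
  by right => t /mind[/ld td _]; rewrite itv_boundlr negb_and td.
case: ue => [ue|ue]; last first.
  by right => t /mind[_ /ue te]; rewrite itv_boundlr negb_and te orbT.
by left => t /mind[/ld td /ue te]; rewrite itv_boundlr td te.
Qed.

(** Membership in each of finitely many intervals is settled just to the right of [a]. All uses of
    tameness go through this dichotomy. *)
Lemma definable_germ (R : realType) (D : forall n, set (set 'rV[R]_n))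
    (hD : o_minimal D) (P : R -> Prop) (a : R) :
  D 1%N [set x | P (x ord0 ord0)] ->
  exists2 d : R, 0 < d & (forall t, a < t < a + d -> P t) \/
                     (forall t, a < t < a + d -> ~ P t).
Proof.
move=> /(o_minimal_tame hD)[s sE].
have {sE} PE t : P t <-> exists2 i, i \in s & t \in i.
  have := congr1 (fun A : set 'rV[R]_1 => A (const_mx t)) sE.
  by rewrite /= mxE => ->.
suff [d d0 H] : exists2 d : R, 0 < d &
    (forall t, a < t < a + d -> exists2 i, i \in s & t \in i) \/
    (forall t, a < t < a + d -> forall i, i \in s -> t \notin i).
  exists d => //; case: H => H; [left|right] => t /H; first by move/PE.
  by move=> nH /PE[i /nH/negP].
elim: s {PE} => [|i s [d d0 IH]]; first by exists 1 => //; right.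
have [e e0 ie] := itv_germ i a.
exists (Num.min d e); first by rewrite lt_min d0.
have mind t : a < t < a + Num.min d e -> a < t < a + d /\ a < t < a + e.
  move=> /andP[-> /= tde].
  by split; apply: lt_le_trans tde _; rewrite lerD2l ge_min lexx ?orbT.
case: IH => IH.
  by left => t /mind[/IH[j js tj] _]; exists j => //; rewrite inE js orbT.
case: ie => ie.
  by left => t /mind[_ /ie ti]; exists i => //; rewrite inE eqxx.
right => t /mind[tI ti] j; rewrite inE => /orP[/eqP ->|]; first exact: ie.
exact: IH.
Qed.

(* The completeness required by [Baire]; the library does not register it. *)
HB.instance Definition _ (R : realType) (m n : nat) := Complete.on 'M[R]_(m, n).

Lemma Baire_countable (R : realType) n (T : countType) (F : T -> set 'rV[R]_n) :
  (forall i, open (F i) /\ dense (F i)) -> dense (\bigcap_i (F i)).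
Proof.
move=> odF.
(* Integers that encode no index contribute the whole space. *)
pose G k := if unpickle k is Some i then F i else setT.
have odG k : open (G k) /\ dense (G k).
  rewrite /G; case: (@unpickle T k) => [i|]; first exact: odF.
  by split; [exact: openT|move=> O [x Ox] _; exists x].
move=> O O0 oO; have [x [Ox Gx]] := @Baire R 'rV[R]_n G odG O O0 oO.
exists x; split => // i _; have := Gx (pickle i) I.
by rewrite /G pickleK.
Qed.

Lemma const_mx_rV1 (R : realType) (t : 'rV[R]_1) : const_mx (t ord0 ord0) = t.
Proof. by apply/rowP => i; rewrite [i]ord1 mxE. Qed.

(* Induction on the dimension. In every fiber over the first [n] coordinates the
   germ of [X] at [a^+] is empty or full on an interval of length [1 / k.+1], so
   countably many definable sets of dimension [n] cover the base, and Baire's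
   theorem gives one of them an interior. *)
Lemma definable_interior_dense (R : realType)
    (D : forall n, set (set 'rV[R]_n)) (hD : o_minimal D) n (X : set 'rV[R]_n) :
  D n X -> dense (X° `|` (~` X)°).
Proof.
elim: n X => [|n IH] X.
  move=> _ O [x Ox] _; exists x; split => //.
  have [Xx|nXx] := pselect (X x); [left|right]; apply/nbhs_cubeP; exists 1 => // y _.
    by rewrite (_ : y = x)//; apply/rowP => -[].
  by rewrite (_ : y = x)//; apply/rowP => -[].
move: X; rewrite -[n.+1]addn1 => X dX O [x Ox] oO.
have /nbhs_cubeP[e e0 xeO] : nbhs x O by apply: open_nbhs_nbhs.
pose a := rsubmx x ord0 ord0.
pose Q (b : bool) (z : 'rV[R]_(n + 1)) := if b then X z else ~ X z.
have dQ b : D (n + 1)%N [set z | Q b z].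
  by case: b; [exact: dX|exact: (definableC hD) dX].
pose P (bk : bool * nat) := [set y : 'rV[R]_n |
  forall t, a < t /\ t < a + bk.2.+1%:R^-1 -> Q bk.1 (row_mx y (const_mx t))].
have dP bk : D n (P bk).
  apply: (@definable_all1 _ _ hD _ (fun y t =>
    a < t /\ t < a + bk.2.+1%:R^-1 -> Q bk.1 (row_mx y (const_mx t)))).
  apply: (definable_imp hD).
    apply: (definableI hD); apply: (definable_lt hD); try exact: polyfun_cst.
      exact: polymap_rsub (@polymap_id _ _) _.
    exact: polymap_rsub (@polymap_id _ _) _.
  have := dQ bk.1; congr (D _); apply/funext => z /=; congr (Q _ _).
  by rewrite const_mx_rV1 hsubmxK.
have dF bk : open ((P bk)° `|` (~` P bk)°) /\ dense ((P bk)° `|` (~` P bk)°).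
  by split; [apply: openU; exact: open_interior|exact: IH].
have [||y [xy Fy]] := Baire_countable dF (O := eball (lsubmx x) e).
- by exists (lsubmx x); rewrite /eball /= subrr enorm0.
- exact: open_eball.
have [d d0 dX'] : exists2 d : R, 0 < d &
    (forall t, a < t < a + d -> X (row_mx y (const_mx t))) \/
    (forall t, a < t < a + d -> ~ X (row_mx y (const_mx t))).
  apply: (definable_germ hD).
  apply: (definable_subst hD (P := X)) => //.
  apply: polymap_row; first exact: polymap_cst.
  by move=> i; exists (mpolyX R (mnm1 ord0)) => z; rewrite mevalXU mxE.
have [k kd] : exists k, a + k.+1%:R^-1 < a + d.
  by apply: ltr_add_invr; rewrite ltrDl.
have {dX'} [b Pby] : exists b, P (b, k) y.
  by case: dX' => H; [exists true|exists false] => t /= [at_ tk]; apply: H;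
    rewrite at_ (lt_trans tk).
have {Fy} : (P (b, k))° y.
  by have [//|/interior_subset] := Fy (b, k) I.
move=> /nbhs_cubeP[r r0 yrP].
(* The cube of radius [h] around height [a + h] stays above [a], and [2 * h] exceeds neither [e] nor
   the length on which the germ is known. *)
pose h : R := Num.min e k.+1%:R^-1 / 2.
have h0 : 0 < h by rewrite divr_gt0// lt_min e0 invr_gt0 ltr0n.
have he : 2 * h <= e by rewrite mulrC divfK ?ge_min ?lexx.
have hk : 2 * h <= k.+1%:R^-1 by rewrite mulrC divfK ?ge_min ?lexx ?orbT.
exists (row_mx y (const_mx (a + h))); split.
  apply: xeO => i; case: (split_ordP i) => j ->.
    rewrite row_mxEl; have := coord_le_enorm (y - lsubmx x) j.
    by rewrite !mxE => /le_lt_trans; apply.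
  rewrite row_mxEr mxE [j]ord1 /a mxE addrAC subrr add0r gtr0_norm//.
  by move: h0 he; lra.
have nbQ : nbhs (row_mx y (const_mx (a + h))) (Q b).
  apply/nbhs_cubeP; exists (Num.min r h); first by rewrite lt_min r0.
  move=> z zyh.
  have : P (b, k) (lsubmx z).
    apply: yrP => i; have := zyh (lshift 1 i).
    by rewrite row_mxEl mxE lt_min => /andP[].
  rewrite -(hsubmxK z) -(const_mx_rV1 (rsubmx z)) row_mxKl; apply.
  have := zyh (rshift n ord0); rewrite row_mxEr [const_mx _ _ _]mxE lt_min.
  move=> /andP[_]; rewrite ltr_norml [rsubmx _ _ _]mxE.
  move: (z _ _) => w /andP[/= wa wb]; move: k.+1%:R^-1 hk => k' hk.
  by clear -wa wb hk h0; split; lra.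
by case: b Pby yrP nbQ => _ _ nbQ; [left|right].
Qed.

(** * Generic continuous differentiability of definable maps *)

Section StrictPartial.
Variables (R : realType) (D : forall n, set (set 'rV[R]_n)).
Arguments D : clear implicits.
Hypothesis hD : o_minimal D.
Variables (m n : nat) (f : 'rV[R]_m -> 'rV[R]_n).
Hypotheses (f_cont : continuous f) (f_def : definable_map D f).

(** The difference quotient is cleared of its denominator, so that the condition is polynomial in
    [q], [h] and the two values of [f]. *)
Definition slope_above (v : 'rV[R]_m) (j : 'I_n) (q : R) (x : 'rV[R]_m) :=
  exists d : R, 0 < d /\ forall h : R, 0 < h /\ h < d ->
    q * h < f (x + h *: v) ord0 j - f x ord0 j.

(** Increments may start at any [y] near [x]: this strict form of the derivative brings continuity
    with it. Absolute values are split into pairs of inequalities to keep the formula polynomial. *)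
Definition strict_partial (v : 'rV[R]_m) (j : 'I_n) (x : 'rV[R]_m) :=
  exists k : R, forall e : R, 0 < e -> exists d : R, 0 < d /\
    forall y : 'rV[R]_m, (forall i, y ord0 i - x ord0 i < d /\ x ord0 i - y ord0 i < d) ->
    forall t : R, 0 < t /\ t < d ->
      f (y + t *: v) ord0 j - f y ord0 j - k * t <= e * t /\
      k * t - (f (y + t *: v) ord0 j - f y ord0 j) <= e * t.

Lemma definable_increment N (xx : 'rV[R]_N -> 'rV[R]_m) (tt : 'rV[R]_N -> R) v j
    (P : 'rV[R]_N -> R -> Prop) :
  polymap xx -> polyfun tt ->
  D (N + 1) [set z | P (lsubmx z) (rsubmx z ord0 ord0)] ->
  D N [set z | P z (f (xx z + tt z *: v) ord0 j - f (xx z) ord0 j)].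
Proof.
move=> xp tp dP.
apply: (@definable_app _ _ hD _ _ _ f (fun z => xx z + tt z *: v)
  (fun z a => P z (a ord0 j - f (xx z) ord0 j))) => //.
  by apply: polymapD => //; apply: polymapZ => //; exact: polymap_cst.
apply: (@definable_app _ _ hD _ _ _ f (fun z => xx (lsubmx z))
  (fun z b => P (lsubmx z) (rsubmx z ord0 j - b ord0 j))) => //.
  exact: polymap_comp (polymap_lsub (@polymap_id _ _)) xp.
have := @definable_subst _ _ hD _ _
  (fun z : 'rV[R]_(N + n + n) => row_mx (lsubmx (lsubmx z))
    (const_mx (rsubmx (lsubmx z) ord0 j - rsubmx z ord0 j) : 'rV[R]_1)) _ _ dP.
set H := [set x | P _ _]; rewrite (_ : [set z | P _ _] = H).
  apply; apply: polymap_row.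
    by apply: polymap_lsub; apply: polymap_lsub; exact: polymap_id.
  move=> i; have [p pE] : polyfun (fun z : 'rV[R]_(N + n + n) =>
      rsubmx (lsubmx z) ord0 j - rsubmx z ord0 j).
    apply: polyfunB; first exact: polymap_rsub (polymap_lsub (@polymap_id _ _)) _.
    exact: polymap_rsub (@polymap_id _ _) _.
  by exists p => z; rewrite -pE [const_mx _ _ _]mxE.
by apply/funext => z; rewrite /H /mkset row_mxKl row_mxKr [const_mx _ _ _]mxE.
Qed.

Lemma definable_slope_above N (xx : 'rV[R]_N -> 'rV[R]_m) (qq : 'rV[R]_N -> R) v j :
  polymap xx -> polyfun qq -> D N [set z | slope_above v j (qq z) (xx z)].
Proof.
move=> xp qp.
apply: (@definable_ex1 _ _ hD _ (fun z (d : R) => 0 < d /\ forall h, 0 < h /\ h < d ->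
    qq z * h < f (xx z + h *: v) ord0 j - f (xx z) ord0 j)).
apply: (definableI hD).
  apply: (definable_lt hD); first exact: polyfun_cst.
  exact: polymap_rsub (@polymap_id _ _) _.
apply: (@definable_all1 _ _ hD _ (fun z (h : R) => 0 < h /\ h < rsubmx z ord0 ord0 ->
  qq (lsubmx z) * h < f (xx (lsubmx z) + h *: v) ord0 j - f (xx (lsubmx z)) ord0 j)).
have P1 : polymap (fun z : 'rV[R]_(N + 1 + 1) => lsubmx (lsubmx z)).
  by apply: polymap_lsub; apply: polymap_lsub; exact: polymap_id.
have P2 : polyfun (fun z : 'rV[R]_(N + 1 + 1) => rsubmx z ord0 ord0).
  exact: polymap_rsub (@polymap_id _ _) _.
apply: (definable_imp hD).
  apply: (definableI hD); apply: (definable_lt hD) => //; first exact: polyfun_cst.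
  exact: polymap_rsub (polymap_lsub (@polymap_id _ _)) _.
apply: (@definable_increment _ (fun z => xx (lsubmx (lsubmx z)))
  (fun z => rsubmx z ord0 ord0) v j
  (fun z a => qq (lsubmx (lsubmx z)) * rsubmx z ord0 ord0 < a)) => //.
  exact: polymap_comp P1 xp.
have P3 : polymap (fun z : 'rV[R]_(N + 1 + 1 + 1) => lsubmx z).
  by apply: polymap_lsub; exact: polymap_id.
apply: (definable_lt hD); last exact: polymap_rsub (@polymap_id _ _) _.
apply: polyfunM; last exact: polyfun_comp P3 P2.
exact: polyfun_comp (polymap_comp P3 P1) qp.
Qed.

Lemma definable_strict_partial v j : D m [set x | strict_partial v j x].
Proof.
pose T (k e : R) (y : 'rV[R]_m) (t : R) := f (y + t *: v) ord0 j - f y ord0 j - k * t <= e * t /\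
      k * t - (f (y + t *: v) ord0 j - f y ord0 j) <= e * t.
pose C (x y : 'rV[R]_m) (d : R) :=
  forall i, y ord0 i - x ord0 i < d /\ x ord0 i - y ord0 i < d.
apply: (@definable_ex1 _ _ hD _ (fun x (k : R) => forall e : R, 0 < e -> exists d : R, 0 < d /\
    forall y, C x y d -> forall t : R, 0 < t /\ t < d -> T k e y t)).
apply: (@definable_all1 _ _ hD _ (fun z (e : R) => 0 < e -> exists d : R, 0 < d /\
    forall y, C (lsubmx z) y d -> forall t : R, 0 < t /\ t < d ->
      T (rsubmx z ord0 ord0) e y t)).
have r0 N : polyfun (fun z : 'rV[R]_(N + 1) => rsubmx z ord0 ord0).
  exact: polymap_rsub (@polymap_id _ _) _.
have rm N : polymap (fun z : 'rV[R]_(N + m) => rsubmx z).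
  by apply: polymap_rsub; exact: polymap_id.
have l N N' N'' (g : 'rV[R]_(N + N') -> 'rV[R]_N'') :
    polymap g -> polymap (fun z : 'rV[R]_(N + N' + 1) => g (lsubmx z)).
  by apply: polymap_comp; apply: polymap_lsub; exact: polymap_id.
have l0 N N' : polymap (fun z : 'rV[R]_(N + N') => lsubmx z).
  by apply: polymap_lsub; exact: polymap_id.
apply: (definable_imp hD).
  by apply: (definable_lt hD) => //; exact: polyfun_cst.
apply: (@definable_ex1 _ _ hD _ (fun z (d : R) => 0 < d /\
    forall y, C (lsubmx (lsubmx z)) y d -> forall t : R, 0 < t /\ t < d ->
      T (rsubmx (lsubmx z) ord0 ord0) (rsubmx z ord0 ord0) y t)).
apply: (definableI hD).
  by apply: (definable_lt hD) => //; exact: polyfun_cst.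
apply: (@definable_all _ _ hD _ _ (fun z y =>
    C (lsubmx (lsubmx (lsubmx z))) y (rsubmx z ord0 ord0) ->
    forall t : R, 0 < t /\ t < rsubmx z ord0 ord0 ->
      T (rsubmx (lsubmx (lsubmx z)) ord0 ord0) (rsubmx (lsubmx z) ord0 ord0) y t)).
have x4 : polymap (fun z : 'rV[R]_(m + 1 + 1 + 1 + m) =>
    lsubmx (lsubmx (lsubmx (lsubmx z)))).
  by do 4!apply: polymap_lsub; exact: polymap_id.
have d4 : polyfun (fun z : 'rV[R]_(m + 1 + 1 + 1 + m) =>
    rsubmx (lsubmx z) ord0 ord0).
  exact: polymap_rsub (polymap_lsub (@polymap_id _ _)) _.
apply: (definable_imp hD).
  apply: (definable_forall_fin hD) => i; apply: (definableI hD);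
  apply: (definable_lt hD) => //; apply: polyfunB; by [exact: x4|exact: rm].
apply: (@definable_all1 _ _ hD _ (fun z (t : R) => 0 < t /\ t < rsubmx (lsubmx z) ord0 ord0 ->
  T (rsubmx (lsubmx (lsubmx (lsubmx z))) ord0 ord0)
    (rsubmx (lsubmx (lsubmx z)) ord0 ord0) (rsubmx z) t)).
apply: (definable_imp hD).
  apply: (definableI hD); apply: (definable_lt hD) => //; first exact: polyfun_cst.
  exact: polyfun_comp (l0 _ _) d4.
apply: (@definable_increment _ (fun z => rsubmx (lsubmx z))
  (fun z => rsubmx z ord0 ord0) v j (fun z a =>
   let k := rsubmx (lsubmx (lsubmx (lsubmx (lsubmx z)))) ord0 ord0 in
   let e := rsubmx (lsubmx (lsubmx (lsubmx z))) ord0 ord0 in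
   let t := rsubmx z ord0 ord0 in
   a - k * t <= e * t /\ k * t - a <= e * t)) => //.
  exact: polymap_comp (l0 _ _) (rm _).
have k7 : polyfun (fun z : 'rV[R]_(m + 1 + 1 + 1 + m + 1 + 1) =>
    rsubmx (lsubmx (lsubmx (lsubmx (lsubmx (lsubmx z))))) ord0 ord0).
  by apply: polymap_rsub; do 5!apply: polymap_lsub; exact: polymap_id.
have e7 : polyfun (fun z : 'rV[R]_(m + 1 + 1 + 1 + m + 1 + 1) =>
    rsubmx (lsubmx (lsubmx (lsubmx (lsubmx z)))) ord0 ord0).
  by apply: polymap_rsub; do 4!apply: polymap_lsub; exact: polymap_id.
have t7 : polyfun (fun z : 'rV[R]_(m + 1 + 1 + 1 + m + 1 + 1) =>
    rsubmx (lsubmx z) ord0 ord0).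
  by apply: polymap_rsub; apply: polymap_lsub; exact: polymap_id.
by apply: (definableI hD); apply: (definable_le hD) => //;
  repeat (apply: polyfunB || apply: polyfunM) => //.
Qed.

(** With cubes as neighborhoods, being interior is a first-order condition. *)
Lemma definable_interior n' (X : set 'rV[R]_n') : D n' X -> D n' X°.
Proof.
move=> dX.
pose C (x y : 'rV[R]_n') (d : R) :=
  forall i, y ord0 i - x ord0 i < d /\ x ord0 i - y ord0 i < d.
have -> : X° = [set x | exists d : R, 0 < d /\ forall y, C x y d -> X y].
  apply/seteqP; split => x /=.
    move=> /nbhs_cubeP[e e0 xeX]; exists e; split => // y xy; apply: xeX => i.
    by have [? ?] := xy i; rewrite ltr_norml; apply/andP; split; lra.
  move=> [d [d0 xdX]]; apply/nbhs_cubeP; exists d => // y xy; apply: xdX => i.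
  by have := xy i; rewrite ltr_norml => /andP[? ?]; split; lra.
apply: (@definable_ex1 _ _ hD _ (fun x (d : R) => 0 < d /\ forall y, C x y d -> X y)).
apply: (definableI hD).
  apply: (definable_lt hD); first exact: polyfun_cst.
  exact: polymap_rsub (@polymap_id _ _) _.
apply: (@definable_all _ _ hD _ _ (fun z y => C (lsubmx z) y (rsubmx z ord0 ord0) -> X y)).
apply: (definable_imp hD).
  apply: (definable_forall_fin hD) => i; apply: (definableI hD);
  apply: (definable_lt hD); try apply: polyfunB;
  try exact: (polymap_rsub (@polymap_id _ _) _);
  try exact: (polymap_rsub (polymap_lsub (@polymap_id _ _)) _);
  exact: (polymap_lsub (polymap_lsub (@polymap_id _ _)) _).
by apply: (definable_subst hD) => //; apply: polymap_rsub; exact: polymap_id.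
Qed.

End StrictPartial.

(** * Slopes along lines *)

Lemma right_slope_ge (R : realType) (g : R -> R) (a b q : R) : a <= b ->
  (forall t, a <= t <= b -> {for t, continuous g}) ->
  (forall t, a <= t < b -> exists2 d : R, 0 < d &
     forall s, t < s < t + d -> q * (s - t) <= g s - g t) ->
  q * (b - a) <= g b - g a.
Proof.
move=> ab cg lg.
suff : g a - q * a <= g b - q * b by rewrite mulrBr; lra.
apply: (@right_increasing _ (fun t => g t - q * t)) => // t tab.
  apply: continuousB; first exact: cg.
  by apply: continuousM; [exact: cvg_cst|exact: cvg_id].
have [d d0 H] := lg t tab; exists d => // s /H; rewrite mulrBr; lra.
Qed.

Lemma affine_continuous (R : realType) m (x v : 'rV[R]_m) :
  continuous (fun t : R => x + t *: v).
Proof.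
by move=> t; apply: cvgD; [exact: cvg_cst|apply: cvgZr_tmp; exact: cvg_id].
Qed.

Lemma line_continuous (R : realType) m n (f : 'rV[R]_m -> 'rV[R]_n) x v w :
  continuous f -> continuous (fun t : R => dot (f (x + t *: v)) w).
Proof.
move=> cf t; apply: (@cvg_comp _ _ _ (fun t : R => f (x + t *: v))
  (fun u => dot u w) (nbhs t) (nbhs (f (x + t *: v)))); last exact: dotl_continuous.
apply: (@cvg_comp _ _ _ (fun t : R => x + t *: v) f (nbhs t) (nbhs (x + t *: v))).
  exact: affine_continuous.
exact: cf.
Qed.

Lemma coord_dot (R : realType) n (u : 'rV[R]_n) j :
  u ord0 j = dot u (delta_mx ord0 j).
Proof.
rewrite /dot (bigD1 j)//= mxE !eqxx mulr1 big1 ?addr0// => i ij.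
by rewrite mxE (negPf ij) andbF mulr0.
Qed.

Section SlopeMonotone.
Variables (R : realType) (D : forall n, set (set 'rV[R]_n)).
Arguments D : clear implicits.
Hypothesis hD : o_minimal D.
Variables (m n : nat) (f : 'rV[R]_m -> 'rV[R]_n).
Hypotheses (f_cont : continuous f) (f_def : definable_map D f).
Variables (v : 'rV[R]_m) (j : 'I_n).

Let line_cont x : continuous (fun t : R => f (x + t *: v) ord0 j).
Proof.
move=> t; rewrite (_ : (fun t => _) =
    (fun t => dot (f (x + t *: v)) (delta_mx ord0 j))).
  exact: line_continuous.
by apply/funext => s; rewrite coord_dot.
Qed.

Lemma slope_above_incr q x (s : R) : 0 <= s ->
  (forall t, 0 <= t < s -> slope_above f v j q (x + t *: v)) ->
  q * s <= f (x + s *: v) ord0 j - f x ord0 j.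
Proof.
move=> s0 H; have := @right_slope_ge _ (fun t => f (x + t *: v) ord0 j) 0 s q s0.
rewrite subr0 scale0r addr0; apply; first by move=> t _; exact: line_cont.
move=> t /H[d [d0 Hd]]; exists d => // r /andP[tr rd].
have := Hd (r - t); rewrite -addrA -scalerDl subrKC => H2.
by apply: ltW; apply: H2; lra.
Qed.

(** The negation of [slope_above] only provides arbitrarily small [h] with increment at most
    [q * h]; the dichotomy of germs at 0 makes this hold for all small [h], and [right_slope_ge]
    applies to [- f]. *)
Lemma slope_not_above_incr q x (s : R) : 0 <= s ->
  (forall t, 0 <= t < s -> ~ slope_above f v j q (x + t *: v)) ->
  f (x + s *: v) ord0 j - f x ord0 j <= q * s.
Proof.
move=> s0 H; rewrite -lerN2 -mulNr.
have := @right_slope_ge _ (fun t => - f (x + t *: v) ord0 j) 0 s (- q) s0.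
rewrite subr0 scale0r addr0 opprB opprK addrC; apply.
  by move=> t _; apply: continuousN; exact: line_cont.
move=> t /H nH.
have [d d0 Hd] : exists2 d : R, 0 < d &
    (forall h, 0 < h < 0 + d ->
      q * h < f (x + t *: v + h *: v) ord0 j - f (x + t *: v) ord0 j) \/
    (forall h, 0 < h < 0 + d ->
      ~ q * h < f (x + t *: v + h *: v) ord0 j - f (x + t *: v) ord0 j).
  apply: (@definable_germ _ _ hD (fun h => q * h <
    f (x + t *: v + h *: v) ord0 j - f (x + t *: v) ord0 j)).
  apply: (@definable_increment _ _ hD _ _ _ f_def _ (fun=> x + t *: v)
    (fun z => z ord0 ord0) v j (fun z a => q * z ord0 ord0 < a)).
  - exact: polymap_cst.
  - exact: (@polymap_id _ _ ord0).
  - apply: (definable_lt hD); last exact: polymap_rsub (@polymap_id _ _) _.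
    apply: polyfunM; first exact: polyfun_cst.
    exact: polymap_lsub (@polymap_id _ _) _.
exists d => // r /andP[tr rd]; case: Hd => Hd.
  exfalso; apply: nH; exists d; split => // h [h0 hd].
  by apply: Hd; rewrite h0 add0r.
have := Hd (r - t); rewrite -addrA -scalerDl subrKC => H2.
have /negP : ~ q * (r - t) < f (x + r *: v) ord0 j - f (x + t *: v) ord0 j.
  by apply: H2; lra.
by rewrite -leNgt mulNr opprK; lra.
Qed.

Lemma slope_above_mono q q' x : q' <= q ->
  slope_above f v j q x -> slope_above f v j q' x.
Proof.
move=> qq [d [d0 H]]; exists d; split => // h [h0 hd].
by apply: le_lt_trans (H h (conj h0 hd)); rewrite ler_pM2r.
Qed.

(** A countable family, for Baire's theorem: the rational thresholds, and the two sets where the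
    lower right slope is infinite, positively for [inr true] and negatively for [inr false]. *)
Definition slope_test (i : rat + bool) : set 'rV[R]_m :=
  match i with
  | inl q => [set x | slope_above f v j (ratr q) x]
  | inr true => [set x | forall q, slope_above f v j q x]
  | inr false => [set x | forall q, ~ slope_above f v j q x]
  end.

Lemma definable_slope_test i : D m (slope_test i).
Proof.
have H : D (m + 1)%N [set z | slope_above f v j (rsubmx z ord0 ord0) (lsubmx z)].
  apply: (@definable_slope_above _ _ hD _ _ _ f_def).
    exact: polymap_lsub (@polymap_id _ _).
  exact: polymap_rsub (@polymap_id _ _) _.
case: i => [q|[]] /=.
- apply: (@definable_slope_above _ _ hD _ _ _ f_def); first exact: polymap_id.
  exact: polyfun_cst.
- exact: (@definable_all1 _ _ hD _ (fun x q => slope_above f v j q x)).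
- apply: (@definable_all1 _ _ hD _ (fun x q => ~ slope_above f v j q x)).
  exact: (definableC hD).
Qed.

Hypothesis v1 : forall i, `|v ord0 i| <= 1.

Let cube_line (x y : 'rV[R]_m) (t d : R) : (forall i, `|y ord0 i - x ord0 i| < d) -> 0 <= t < d ->
  forall i, `|(y + t *: v) ord0 i - x ord0 i| < 2 * d.
Proof.
move=> xy /andP[t0 td] i; rewrite !mxE.
have : `|t * v ord0 i| <= t.
  by rewrite normrM ger0_norm// ler_piMr.
have := xy i; rewrite addrAC => yd tt; apply: le_lt_trans (ler_normD _ _) _; lra.
Qed.

(* The supremum of the [q] with [slope_above q x] is finite, since no open set can
   have all its slopes above every [q], or above none. It is the strict partial
   derivative because the tests for rational [q] are constant near [x]. *)
Lemma strict_partial_generic x :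
  (forall i, ((slope_test i)° `|` (~` slope_test i)°) x) ->
  strict_partial f v j x.
Proof.
move=> gx.
have in_int i : slope_test i x -> (slope_test i)° x.
  by move=> ix; case: (gx i) => // /interior_subset.
have out_int i : ~ slope_test i x -> (~` slope_test i)° x.
  by move=> ix; case: (gx i) => // /interior_subset.
have [q0 nq0] : exists q, ~ slope_above f v j q x.
  apply/existsNP => /(in_int (inr true))/nbhs_cubeP[e e0 He].
  have ex t : 0 <= t < e -> forall q, slope_above f v j q (x + t *: v).
    move=> te; apply: He => i; have := @cube_line x x t e _ te i.
    rewrite !mxE addrAC subrr add0r normrM => _.
    have /andP[t0 tlte] := te; rewrite ger0_norm//.
    by apply: le_lt_trans tlte; rewrite ler_piMr.
  pose s := e / 2; have s0 : 0 < s by rewrite divr_gt0.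
  (* A threshold exceeding the mean slope over [[0, s]] by 1: the increment would be at least itself
     plus [s]. *)
  pose q := (f (x + s *: v) ord0 j - f x ord0 j) / s + 1.
  have qs : q * s = f (x + s *: v) ord0 j - f x ord0 j + s.
    by rewrite /q mulrDl mul1r divfK ?gt_eqF.
  suff : q * s <= f (x + s *: v) ord0 j - f x ord0 j by rewrite qs; lra.
  apply: (slope_above_incr (ltW s0)) => t /andP[t0 ts]; apply: ex.
  by rewrite t0 (lt_le_trans ts)// /s; lra.
have [q1 Hq1] : exists q, slope_above f v j q x.
  apply: contrapT => /forallNP/(in_int (inr false))/nbhs_cubeP[e e0 He].
  have ex t : 0 <= t < e -> forall q, ~ slope_above f v j q (x + t *: v).
    move=> te; apply: He => i; rewrite !mxE addrAC subrr add0r normrM.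
    have /andP[t0 tlte] := te; rewrite ger0_norm//.
    by apply: le_lt_trans tlte; rewrite ler_piMr.
  pose s := e / 2; have s0 : 0 < s by rewrite divr_gt0.
  pose q := (f (x + s *: v) ord0 j - f x ord0 j) / s - 1.
  have qs : q * s = f (x + s *: v) ord0 j - f x ord0 j - s.
    by rewrite /q mulrDl mulN1r divfK ?gt_eqF.
  suff : f (x + s *: v) ord0 j - f x ord0 j <= q * s by rewrite qs; lra.
  apply: (slope_not_above_incr (ltW s0)) => t /andP[t0 ts]; apply: ex.
  by rewrite t0 (lt_le_trans ts)// /s; lra.
pose S := [set q | slope_above f v j q x].
have ubS : ubound S q0.
  move=> q Sq; rewrite leNgt; apply/negP => qq; apply: nq0.
  exact: slope_above_mono (ltW qq) Sq.
have supS : has_sup S by split; [exists q1|exists q0].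
exists (sup S) => e e0.
have [r Sr rS] := sup_adherent e0 supS.
(* Rational thresholds [p < sup S < p'] within [e] of [sup S]: the test holds at [p] and fails at
   [p'], not only at [x] but on a cube around it. *)
have [p /= /[!in_itv]/= /andP[p1 p2]] := rat_in_itvoo rS.
have [p' /= /[!in_itv]/= /andP[p1' p2']] : exists p, ratr p \in `]sup S, sup S + e[.
  by apply: rat_in_itvoo; rewrite ltrDl.
have Sp : S (ratr p) by apply: slope_above_mono Sr; exact: ltW.
have Sp' : ~ S (ratr p').
  move=> Sp'; have : ratr p' <= sup S by apply: ub_le_sup => //; exists q0.
  by rewrite leNgt p1'.
have /nbhs_cubeP[d d0 Hd] := in_int (inl p) Sp.
have /nbhs_cubeP[d' d0' Hd'] := out_int (inl p') Sp'.
pose h := Num.min d d' / 2.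
have h0 : 0 < h by rewrite divr_gt0// lt_min d0.
have hd : 2 * h <= d by rewrite mulrC divfK// ge_min lexx.
have hd' : 2 * h <= d' by rewrite mulrC divfK// ge_min lexx orbT.
exists h; split => // y xy t [t0 th].
have yh i : `|y ord0 i - x ord0 i| < h.
  by have [? ?] := xy i; rewrite ltr_norml; apply/andP; split; lra.
have H1 : ratr p * t <= f (y + t *: v) ord0 j - f y ord0 j.
  apply: slope_above_incr; first exact: ltW.
  move=> s /andP[s0 st]; apply: Hd => i; apply: lt_le_trans hd.
  by apply: cube_line => //; rewrite s0 (lt_trans st).
have H2 : f (y + t *: v) ord0 j - f y ord0 j <= ratr p' * t.
  apply: slope_not_above_incr; first exact: ltW.
  move=> s /andP[s0 st]; apply: Hd' => i; apply: lt_le_trans hd'.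
  by apply: cube_line => //; rewrite s0 (lt_trans st).
have H3 : (sup S - e) * t <= ratr p * t by rewrite ler_pM2r// ltW.
have H4 : ratr p' * t <= (sup S + e) * t by rewrite ler_pM2r// ltW.
by split; lra.
Qed.

End SlopeMonotone.

Section StrictDense.
Variables (R : realType) (D : forall n, set (set 'rV[R]_n)).
Arguments D : clear implicits.
Hypothesis hD : o_minimal D.
Variables (m n : nat) (f : 'rV[R]_m -> 'rV[R]_n).
Hypotheses (f_cont : continuous f) (f_def : definable_map D f).

Definition all_strict_partial : set 'rV[R]_m :=
  [set x | forall i j, strict_partial f (delta_mx ord0 i) j x].

Lemma definable_all_strict_partial : D m all_strict_partial.
Proof.
apply: (definable_forall_fin hD) => i; apply: (definable_forall_fin hD) => j.
exact: (definable_strict_partial hD f_def).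
Qed.

Lemma all_strict_partial_dense : dense all_strict_partial.
Proof.
pose F (k : 'I_m * 'I_n * (rat + bool)) :=
  let A := slope_test f (delta_mx ord0 k.1.1) k.1.2 k.2 in A° `|` (~` A)°.
have odF k : open (F k) /\ dense (F k).
  split; first by apply: openU; exact: open_interior.
  apply: (definable_interior_dense hD); exact: (definable_slope_test hD f_def).
move=> O O0 oO; have [x [Ox Fx]] := Baire_countable odF O0 oO.
exists x; split => // i j; apply: (strict_partial_generic hD f_cont f_def).
  by move=> k; rewrite mxE eqxx /=; case: eqP => _; rewrite ?normr1// normr0.
by move=> k; exact: Fx (i, j, k) I.
Qed.

(** Where a definable set has no interior its complement has some, which density of the set
    forbids. *)
Lemma int_strict_partial_dense : dense (all_strict_partial°).
Proof.
move=> O O0 oO.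
have [x [Ox [Sx|nSx]]] :=
  definable_interior_dense hD definable_all_strict_partial O0 oO.
  by exists x.
have : open (O `&` (~` all_strict_partial)°).
  by apply: openI => //; exact: open_interior.
move=> /all_strict_partial_dense[]; first by exists x.
by move=> y [[_ /interior_subset]].
Qed.

End StrictDense.

(** * Strict partial derivatives and class C^1 *)

Lemma fin_delta (R : realType) (I : finType) (P : I -> R -> Prop) :
  (forall i d d', d' <= d -> P i d -> P i d') ->
  (forall i, exists2 d : R, 0 < d & P i d) ->
  exists2 d : R, 0 < d & forall i, P i d.
Proof.
move=> Pmono H.
have /choice[d dP] i : exists d : R, 0 < d /\ P i d.
  by have [d ? ?] := H i; exists d.
exists (\big[Num.min/1]_i d i).
  by apply: lt_bigmin => // i _; case: (dP i).
move=> i; apply: Pmono (proj2 (dP i)); exact: bigmin_le.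
Qed.

Lemma mx_norm_le (R : realType) m n (A : 'M[R]_(m, n)) c : 0 <= c ->
  (forall i j, `|A i j| <= c) -> `|A| <= c.
Proof.
move=> c0 Ac; rewrite /Num.norm/= mx_normrE; by apply/bigmax_leP; split => //= -[i j] _.
Qed.

Lemma coord_le_mx_norm (R : realType) m n (A : 'M[R]_(m, n)) i j :
  `|A i j| <= `|A|.
Proof.
rewrite [leRHS]/Num.norm/= mx_normrE; apply/bigmax_geP; right => /=.
by exists (i, j).
Qed.

Lemma cvg_mxP (R : realType) (T : Type) (F : set_system T) (FF : Filter F) m n
    (g : T -> 'M[R]_(m, n)) (l : 'M[R]_(m, n)) :
  (forall i j (e : R), 0 < e -> \forall t \near F, `|g t i j - l i j| < e) ->
  g @ F --> l.
Proof.
move=> H; apply/cvgrPdist_le => e e0.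
have /filter_forall : forall i, \forall t \near F, forall j, `|g t i j - l i j| < e.
  by move=> i; apply: filter_forall => j; exact: H.
apply: filterS => t gt; apply: mx_norm_le; first exact: ltW.
by move=> i j; rewrite !mxE distrC ltW.
Qed.

Lemma directional_derivative (R : realType) m n (f : 'rV[R]_m -> 'rV[R]_n) y v
    (e : R) : differentiable f y -> 0 < e ->
  exists2 d : R, 0 < d & forall h, h != 0 -> `|h| < d ->
    enorm (h^-1 *: (f (y + h *: v) - f y) - v *m jacobian f y) < e.
Proof.
move=> dfy e0.
have : h^-1 *: ((f \o shift y) (h *: v) - f y) @[h --> 0^'] --> 'D_v f y.
  exact: diff_derivable.
rewrite deriveEjacobian// => /enorm_cvgP/(_ e e0).
move=> /nbhs_ballP[d /= d0 H]; exists d => // h h0 hd.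
have := H h _ h0; rewrite /= (addrC _ y); apply.
by rewrite /ball/= sub0r normrN.
Qed.

(** The coordinates of [y] are replaced by those of [z] one at a time. The hypothesis is confined to
    points mixing both, so that a cube containing [y] and [z] contains the path. *)
Lemma coord_path (R : realType) n (g : 'rV[R]_n -> R) (y z : 'rV[R]_n)
    (b : 'I_n -> R) :
  (forall i (w : 'rV[R]_n),
     (forall l, w ord0 l = y ord0 l \/ w ord0 l = z ord0 l) ->
     w ord0 i = y ord0 i ->
     `|g (w + (z ord0 i - y ord0 i) *: delta_mx ord0 i) - g w| <= b i) ->
  `|g z - g y| <= \sum_i b i.
Proof.
move=> H.
pose w k : 'rV[R]_n := \row_i (if (i < k)%N then z ord0 i else y ord0 i).
have w0 : w 0%N = y by apply/rowP => i; rewrite mxE.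
have wn : w n = z by apply/rowP => i; rewrite mxE ltn_ord.
have -> : g z - g y = \sum_(0 <= k < n) (g (w k.+1) - g (w k)).
  by rewrite telescope_sumr// w0 wn.
rewrite big_mkord; apply: le_trans (ler_norm_sum _ _ _) _.
apply: ler_sum => i _.
have -> : w i.+1 = w i + (z ord0 i - y ord0 i) *: delta_mx ord0 i.
  apply/rowP => l; rewrite !mxE eqxx/= ltnS.
  have [->|li] := eqVneq l i; first by rewrite leqnn ltnn mulr1 subrKC.
  by rewrite mulr0 addr0 leq_eqVlt val_eqE (negPf li).
apply: H; last by rewrite mxE ltnn.
by move=> l; rewrite mxE; case: ifP; [right|left].
Qed.

Section StrictC1.
Variables (R : realType) (m n : nat) (f : 'rV[R]_m -> 'rV[R]_n).

Let cube (x : 'rV[R]_m) (d : R) : set 'rV[R]_m :=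
  [set y | forall i, `|y ord0 i - x ord0 i| < d].

Definition strict_slope (v : 'rV[R]_m) j x (k : R) :=
  forall e : R, 0 < e -> exists2 d : R, 0 < d & forall y t, cube x d y ->
    cube x d (y + t *: v) -> `|t| < d ->
    `|f (y + t *: v) ord0 j - f y ord0 j - k * t| <= e * `|t|.

(** A negative [t] is handled by exchanging the two endpoints, which strictness allows because any
    base point near [x] is admissible. *)
Lemma strict_partialP v j x : strict_partial f v j x -> exists k, strict_slope v j x k.
Proof.
move=> [k H]; exists k => e /H[d [d0 Hd]]; exists d => // y t xy xyt td.
have cu z : cube x d z ->
    forall i, z ord0 i - x ord0 i < d /\ x ord0 i - z ord0 i < d.
  by move=> xz i; have := xz i; rewrite ltr_norml => /andP[? ?]; split; lra.
have [t0|t0|->] := ltgtP t 0; last first.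
- by rewrite scale0r addr0 subrr mulr0 subr0 normr0 mulr0.
- have := Hd y (cu y xy) t; rewrite t0 (gtr0_norm t0) => -[].
    by split => //; rewrite -(gtr0_norm t0).
  by move=> ? ?; rewrite ler_norml; apply/andP; split; lra.
- have := Hd _ (cu _ xyt) (- t); rewrite (ltr0_norm t0).
  have -> : y + t *: v + - t *: v = y.
    by rewrite -addrA -scalerDl subrr scale0r addr0.
  move=> [].
    by split; [lra|rewrite -(ltr0_norm t0)].
  by move=> ? ?; rewrite ler_norml; apply/andP; split; lra.
Qed.

(** Along a coordinate path the partial increments start at intermediate points; strictness at [x]
    controls them all, with errors that add up. *)
Lemma strict_slope_diff x (A : 'M[R]_(m, n)) :
  (forall i j, strict_slope (delta_mx ord0 i) j x (A i j)) ->
  differentiable f x /\ jacobian f x = A.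
Proof.
move=> H.
have approx (e : R) : 0 < e -> exists2 d : R, 0 < d & forall z, cube x d z ->
    forall j, `|f z ord0 j - f x ord0 j - ((z - x) *m A) ord0 j| <=
      e * \sum_i `|z ord0 i - x ord0 i|.
  move=> e0.
  have [d d0 Hd] : exists2 d : R, 0 < d & forall ij : 'I_m * 'I_n,
      forall y t, cube x d y -> cube x d (y + t *: delta_mx ord0 ij.1) ->
      `|t| < d -> `|f (y + t *: delta_mx ord0 ij.1) ord0 ij.2 -
        f y ord0 ij.2 - A ij.1 ij.2 * t| <= e * `|t|.
    apply: fin_delta.
      move=> ij d d' d'd Hd y t xy xyt td; apply: Hd.
      - by move=> i; exact: lt_le_trans (xy i) d'd.
      - by move=> i; exact: lt_le_trans (xyt i) d'd.
      - exact: lt_le_trans td d'd.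
    by move=> [i j]; have [d d0 Hd] := H i j e e0; exists d.
  exists d => // z xz j; rewrite mulr_sumr.
  pose g (w : 'rV[R]_m) := f w ord0 j - (w *m A) ord0 j.
  rewrite (_ : _ - _ - _ = g z - g x); last first.
    have mxBE (u v : 'rV[R]_n) : (u - v) ord0 j = u ord0 j - v ord0 j.
      by rewrite !mxE.
    by rewrite /g mulmxBl mxBE; ring.
  apply: coord_path => i w wxz wi.
  have xw : cube x d w.
    by move=> l; case: (wxz l) => ->; [rewrite subrr normr0|exact: xz].
  have := Hd (i, j) w (z ord0 i - x ord0 i) xw; rewrite /= => Hij.
  rewrite /g (_ : _ - _ - _ =
    f (w + (z ord0 i - x ord0 i) *: delta_mx ord0 i) ord0 j - f w ord0 j -
    A i j * (z ord0 i - x ord0 i)).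
    apply: Hij; last exact: xz.
    move=> l; rewrite !mxE eqxx /=; have [->|_] := eqVneq l i.
      by rewrite mulr1 wi subrKC; exact: xz.
    by rewrite mulr0 addr0; exact: xw.
  rewrite mulmxDl -scalemxAl -rowE.
  have mxDZE (u v : 'rV[R]_n) a : (u + a *: v) ord0 j = u ord0 j + a * v ord0 j.
    by rewrite !mxE.
  by rewrite mxDZE [row _ _ _ _]mxE; ring.
pose dA : {linear 'rV[R]_m -> 'rV[R]_n} := mulmxr A.
have fE : f \o shift x = cst (f x) + dA +o_ 0 id.
  apply/eqaddoP => e e0.
  have em : 0 < e / m.+1%:R by rewrite divr_gt0 ?ltr0n.
  have [d d0 Hd] := approx _ em.
  apply/nbhs_cubeP; exists d => // h h0d.
  have := Hd (h + x); rewrite addrK => Hh.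
  apply: mx_norm_le; first by rewrite mulr_ge0 ?normr_ge0 ?ltW.
  move=> i j; rewrite [i]ord1.
  have -> : (f \o shift x - (cst (f x) + dA)) h ord0 j =
      f (h + x) ord0 j - f x ord0 j - (h *m A) ord0 j.
    by rewrite -[LHS]/((f (h + x) - (f x + h *m A)) ord0 j) !mxE opprD addrA.
  apply: le_trans (Hh _ j) _.
    by move=> l; have := h0d l; rewrite !mxE addrK subr0.
  rewrite -mulrA ler_pM2l// ler_pdivrMl ?ltr0n//.
  apply: (@le_trans _ _ (\sum_(l < m) `|h|)).
    by apply: ler_sum => l _; rewrite mxE addrK; exact: coord_le_mx_norm.
  by rewrite sumr_const card_ord -[leLHS]mulr_natl ler_wpM2r// ler_nat.
have dAc : continuous dA.
  move=> u; apply: (@cvg_mxP _ _ (nbhs u)) => i j e e0; rewrite [i]ord1.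
  have mulE w : (w *m A) ord0 j = dot w (\row_i A i j).
    by rewrite mxE; apply: eq_bigr => l _; rewrite mxE.
  have /cvg_eballP/(_ e e0)[d d0 Hd] := @dotl_continuous _ _ (\row_i A i j) u.
  by apply/nbhs_eballP; exists d => // w /Hd; rewrite -!mulE.
have dfE := diff_unique dAc fE.
split.
  by apply/diff_locallyP; rewrite dfE.
by apply/row_matrixP => i; rewrite !rowE /jacobian mul_rV_lin1 dfE.
Qed.

(** For [z] near [y], one and the same increment of [f] from [z] is close to the slope at [y] and to
    the slope at [z], so the two slopes are close. *)
Lemma strict_partial_C1 : (all_strict_partial f)° `<=` C1_at f.
Proof.
move=> x /nbhs_interior; apply: filterS => y Sy.
have slopes z : all_strict_partial f z -> exists A : 'M[R]_(m, n),
    forall i j, strict_slope (delta_mx ord0 i) j z (A i j).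
  move=> Sz.
  have /choice[k Hk] (ij : 'I_m * 'I_n) :
      exists k, strict_slope (delta_mx ord0 ij.1) ij.2 z k.
    exact: strict_partialP (Sz _ _).
  by exists (\matrix_(i, j) k (i, j)) => i j; rewrite mxE; exact: Hk (i, j).
have [A HA] := slopes y (interior_subset Sy).
have [dfy JA] := strict_slope_diff HA.
split => //; rewrite /prop_for /continuous_at JA.
apply: (@cvg_mxP _ _ (nbhs y)) => i j e e0.
have e2 : 0 < e / 2 by rewrite divr_gt0.
have [d d0 Hd] := HA i j _ e2.
have /nbhs_cubeP[r r0 yrS] := Sy.
pose h : R := Num.min r (d / 2).
have h0 : 0 < h by rewrite lt_min r0 divr_gt0.
have hr : h <= r by rewrite ge_min lexx.
have hd : 2 * h <= d by have : h <= d / 2 by [rewrite ge_min lexx orbT|]; lra.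
apply/nbhs_cubeP; exists h => // z yz.
have Sz : all_strict_partial f z.
  by apply: yrS => l; exact: lt_le_trans (yz l) hr.
have [B HB] := slopes z Sz.
have [_ ->] := strict_slope_diff HB.
have e4 : 0 < e / 4 by rewrite divr_gt0.
have [d' d'0 Hd'] := HB i j _ e4.
(* A step short enough for both slopes: from [z] it stays in the cube of radius [d] around [y] and
   in that of radius [d'] around [z]. *)
pose t : R := Num.min h d' / 2.
have t0 : 0 < t by rewrite divr_gt0// lt_min h0.
have th : t < h.
  by have : Num.min h d' <= h by [rewrite ge_min lexx|]; rewrite /t; lra.
have td' : t < d'.
  by have : Num.min h d' <= d' by [rewrite ge_min lexx orbT|]; rewrite /t; lra.
have tdelta l : `|(t *: delta_mx ord0 i : 'rV[R]_m) ord0 l| <= t.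
  rewrite !mxE eqxx /=; case: (l == i); first by rewrite mulr1 gtr0_norm.
  by rewrite mulr0 normr0 ltW.
have H1 := Hd z t _ _ _; have H2 := Hd' z t _ _ _.
move: H1 H2; rewrite (gtr0_norm t0).
set u := _ - f z ord0 j => H1 H2.
have {}H1 : `|u - A i j * t| <= e / 2 * t.
  apply: H1; [|move=> l|lra].
    by move=> l; apply: lt_le_trans (yz l) _; lra.
  rewrite mxE addrAC; apply: le_lt_trans (ler_normD _ _) _.
  by have := yz l; have := tdelta l; lra.
have {}H2 : `|u - B i j * t| <= e / 4 * t.
  apply: H2; [|move=> l|lra].
    by move=> l; rewrite subrr normr0.
  rewrite mxE addrAC subrr add0r; apply: le_lt_trans (tdelta l) _; lra.
have : `|(B i j - A i j) * t| <= (e / 2 + e / 4) * t.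
  rewrite (_ : _ * t = (u - A i j * t) - (u - B i j * t)); last by ring.
  by apply: le_trans (ler_normB _ _) _; rewrite mulrDl lerD.
rewrite normrM (gtr0_norm t0) ler_pM2r// => H3.
by apply: le_lt_trans H3 _; lra.
Qed.

End StrictC1.

(** * The mean value inequality *)

Lemma eball_segment (R : realType) n (x y v : 'rV[R]_n) r t :
  eball x r y -> eball x r (y + v) -> 0 <= t <= 1 -> eball x r (y + t *: v).
Proof.
rewrite /eball /= => xy xyv /andP[t0 t1].
have -> : y + t *: v - x = (1 - t) *: (y - x) + t *: (y + v - x).
  by apply/rowP => i; rewrite !mxE; ring.
apply: le_lt_trans (enormD _ _) _; rewrite !enormZ !ger0_norm ?subr_ge0//.
have [->|t0'] := eqVneq t 0; first by rewrite subr0 mul0r addr0 mul1r.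
have : 0 < t by rewrite lt_def t0'.
by have := enorm_ge0 (y - x); nra.
Qed.

Section MeanValue.
Variables (R : realType) (D : forall n, set (set 'rV[R]_n)).
Arguments D : clear implicits.
Hypothesis hD : o_minimal D.
Variables (m n : nat) (f : 'rV[R]_m -> 'rV[R]_n).
Hypotheses (f_cont : continuous f) (f_def : definable_map D f).

Let G := (all_strict_partial f)°.

Let G_open : open G. Proof. exact: open_interior. Qed.

(** Within [G] the directional derivative is at least [al], so right slopes are at least [al - e];
    the loss [e] is removed at the level of increments. *)
Let smooth_segment (U : set 'rV[R]_m) (y v : 'rV[R]_m) (w : 'rV[R]_n) (al a b : R) :
  (forall A, [set jacobian f x | x in U `\` non_C1 f] A -> al <= dot (v *m A) w) ->
  a <= b -> (forall t, a <= t <= b -> G (y + t *: v) /\ U (y + t *: v)) ->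
  al * (b - a) <= dot (f (y + b *: v)) w - dot (f (y + a *: v)) w.
Proof.
move=> Hal ab HG.
suff H (e : R) : 0 < e -> (al - e) * (b - a) <=
    dot (f (y + b *: v)) w - dot (f (y + a *: v)) w.
  have [->|aNb] := eqVneq a b; first by rewrite !subrr mulr0.
  have ab0 : 0 < b - a by rewrite subr_gt0 lt_neqAle aNb.
  rewrite leNgt; apply/negP => Hlt.
  set u := _ - dot (f (y + a *: v)) w in H Hlt.
  have e0 : 0 < (al * (b - a) - u) / (2 * (b - a)).
    by rewrite divr_gt0 ?mulr_gt0// subr_gt0.
  have := H _ e0; rewrite mulrBl.
  have -> : (al * (b - a) - u) / (2 * (b - a)) * (b - a) =
      (al * (b - a) - u) / 2 by field; rewrite gt_eqF.
  lra.
move=> e0.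
apply: (@right_slope_ge _ (fun t => dot (f (y + t *: v)) w)) => //.
  by move=> t _; exact: line_continuous.
move=> t /andP[at_ tb].
have [Gt Ut] : G (y + t *: v) /\ U (y + t *: v) by apply: HG; rewrite at_ ltW.
have C1t : C1_at f (y + t *: v) by apply: strict_partial_C1.
have [dft _] : differentiable f (y + t *: v) /\ _ := nbhs_singleton C1t.
have w0 : 0 < enorm w + 1 by rewrite ltr_wpDl ?enorm_ge0.
have ew : 0 < e / (enorm w + 1) by rewrite divr_gt0.
have [d d0 Hd] := directional_derivative v dft ew.
exists d => // s /andP[ts std].
have st0 : 0 < s - t by rewrite subr_gt0.
have := Hd (s - t); rewrite gt_eqF// gtr0_norm// -addrA -scalerDl subrKC.
move=> /(_ isT) /(_ _) Hs.
have {}Hs := Hs ltac:(lra).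
have : al <= dot (v *m jacobian f (y + t *: v)) w.
  by apply: Hal; exists (y + t *: v) => //; split => //; exact.
set J := v *m _ in Hs *; move=> HJ.
rewrite -dotBl; set u := f _ - f _ in Hs *.
have : dot (J - (s - t)^-1 *: u) w <= e.
  apply: le_trans (dot_le _ _) _; rewrite enormC.
  move: Hs; rewrite ltr_pdivlMr// => Hs.
  by have := enorm_ge0 ((s - t)^-1 *: u - J); nra.
rewrite dotBl dotZl => H.
have : (s - t) * (dot J w - (s - t)^-1 * dot u w) <= (s - t) * e.
  by rewrite ler_pM2l.
rewrite mulrBr mulrA mulfV ?gt_eqF// mul1r.
have : (s - t) * al <= (s - t) * dot J w by rewrite ler_pM2l.
by rewrite mulrBl !(mulrC _ (s - t)); lra.
Qed.

(* For generic [y] the line [y + t *: v] meets the closed definable nowhere dense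
   set [~` G] in no interval, so every [t] has a right neighborhood in [G]. *)
Lemma mean_value_ineq x r (y v : 'rV[R]_m) (w : 'rV[R]_n) (al : R) :
  eball x r y -> eball x r (y + v) ->
  (forall A, [set jacobian f z | z in eball x r `\` non_C1 f] A ->
     al <= dot (v *m A) w) ->
  al <= dot (f (y + v) - f y) w.
Proof.
move=> xy xyv Hal.
(* Base points whose line meets [G] at a parameter between two given rationals: open dense sets,
   countable in number. *)
pose F (pq : rat * rat) : set 'rV[R]_m := if pq.1 < pq.2 then
  [set z | exists2 t : R, ratr pq.1 < t < ratr pq.2 & G (z + t *: v)] else setT.
have shiftG t : open [set z | G (z + t *: v)].
  rewrite openE => z Gz.
  have /nbhs_eballP[e e0 He] : nbhs (z + t *: v) G by apply: open_nbhs_nbhs.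
  apply/nbhs_eballP; exists e => // z' zz'; apply: He.
  by rewrite /eball /= opprD addrACA subrr addr0.
have odF pq : open (F pq) /\ dense (F pq).
  rewrite /F; case: ifP => [pq12|_]; last first.
    by split; [exact: openT|move=> O [z Oz] _; exists z].
  split.
    rewrite openE => z [t tpq Gt].
    have : nbhs z [set z | G (z + t *: v)] by apply: open_nbhs_nbhs.
    by apply: filterS => z' Gz'; exists t.
  move=> O [z Oz] oO.
  pose t : R := (ratr pq.1 + ratr pq.2) / 2.
  have tpq : ratr pq.1 < t < ratr pq.2.
    have : (ratr pq.1 : R) < ratr pq.2 by rewrite ltr_rat.
    by rewrite /t => ?; apply/andP; split; lra.
  have oOt : open [set z' | O (z' - t *: v)].
    rewrite openE => z' Oz'.
    have /nbhs_eballP[e e0 He] : nbhs (z' - t *: v) O by apply: open_nbhs_nbhs.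
    apply/nbhs_eballP; exists e => // z'' zz'; apply: He.
    by rewrite /eball /= opprD addrACA subrr addr0.
  have [|z' [Oz' Gz']] := int_strict_partial_dense hD f_cont f_def _ oOt.
    by exists (z + t *: v); rewrite /= addrK.
  by exists (z' - t *: v); split => //; exists t => //; rewrite subrK.
have generic z : (\bigcap_pq F pq) z -> eball x r z -> eball x r (z + v) ->
    al <= dot (f (z + v) - f z) w.
  move=> Fz xz xzv; rewrite dotBl.
  have := @right_slope_ge _ (fun t => dot (f (z + t *: v)) w) 0 1 al ler01.
  rewrite scale0r addr0 scale1r subr0 mulr1; apply.
    by move=> t _; exact: line_continuous.
  move=> t /andP[t0 t1].
  have dG : D 1%N [set s : 'rV[R]_1 | G (z + s ord0 ord0 *: v)].
    apply: (definable_subst hD (P := fun u => G u)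
      (t := fun s : 'rV[R]_1 => z + s ord0 ord0 *: v)).
      apply: polymapD; first exact: polymap_cst.
      by apply: polymapZ; [exact: (@polymap_id _ _ ord0)|exact: polymap_cst].
    apply: (definable_interior hD).
    exact: (definable_all_strict_partial hD f_def).
  have [d d0 Hd] := definable_germ hD t (P := fun s => G (z + s *: v)) dG.
  case: Hd => Hd; last first.
    exfalso; have td : t < t + d by rewrite ltrDl.
    have [p /=] := rat_in_itvoo td; rewrite in_itv/= => /andP[tp pd].
    have [q /=] := rat_in_itvoo pd; rewrite in_itv/= => /andP[pq qd].
    have := Fz (p, q) I; rewrite /F /= -(ltr_rat R) pq => -[s /andP[ps sq]].
    by apply: Hd; rewrite (lt_trans tp ps) (lt_trans sq qd).
  exists (Num.min d (1 - t)); first by rewrite lt_min d0 subr_gt0.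
  move=> s /andP[ts]; rewrite -ltrBlDl lt_min => /andP[sd s1].
  (* The point at [t] may lie outside [G], so the bound is proved on [[u, s]] with [u > t] and
     carried to [t] by continuity. *)
  rewrite leNgt; apply/negP => gap.
  have /cvg_realP/(_ _ _) H : {for t, continuous
      (fun t : R => dot (f (z + t *: v)) w - al * t)}.
    apply: continuousB; first exact: line_continuous.
    by apply: continuousM; [exact: cvg_cst|exact: cvg_id].
  set phi := fun t => dot (f (z + t *: v)) w in gap H.
  have /H[d' d'0 Hd'] : 0 < al * (s - t) - (phi s - phi t) by rewrite subr_gt0.
  pose u : R := t + Num.min d' (s - t) / 2.
  have m0 : 0 < Num.min d' (s - t) by rewrite lt_min d'0 subr_gt0.
  have m1 : Num.min d' (s - t) <= d' by rewrite ge_min lexx.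
  have m2 : Num.min d' (s - t) <= s - t by rewrite ge_min lexx orbT.
  have tu : t < u by rewrite /u; lra.
  have us : u < s by rewrite /u; lra.
  have /Hd' : `|u - t| < d' by rewrite gtr0_norm ?subr_gt0// /u; lra.
  have := @smooth_segment (eball x r) z v w al u s Hal (ltW us) _.
  rewrite -/(phi s) -/(phi u) => H1.
  have {}H1 : al * (s - u) <= phi s - phi u.
    apply: H1 => t' /andP[ut' t's]; split.
      by apply: Hd; rewrite (lt_le_trans tu ut')/=; lra.
    by apply: eball_segment => //; apply/andP; split; lra.
  move: H1; rewrite ltr_norml /phi /= => H1 /andP[H2 _].
  by rewrite !mulrBr in H1 H2; clearbody u; clear -H1 H2; lra.
(* Generic base points are dense, and the increment is continuous in the base point. *)
rewrite leNgt; apply/negP => gap.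
have fv_cont : continuous (fun z => dot (f (z + v) - f z) w).
  move=> z; apply: (@cvg_comp _ _ _ (fun z => f (z + v) - f z)
    (fun u => dot u w) (nbhs z) (nbhs (f (z + v) - f z))); last exact: dotl_continuous.
  apply: (@cvgB _ _ _ (nbhs z)); last exact: f_cont.
  apply: (@cvg_comp _ _ _ (fun z => z + v) f (nbhs z) (nbhs (z + v))).
    by apply: (@cvgD _ _ _ (nbhs z)); [exact: cvg_id|exact: cvg_cst].
  exact: f_cont.
have /cvg_eballP/(_ _ _) H := fv_cont y.
have gap0 : 0 < al - dot (f (y + v) - f y) w by rewrite subr_gt0.
have [d d0 Hd] := H _ gap0.
pose O := eball y d `&` (eball x r `&` [set z | eball x r (z + v)]).
have oO : open O.
  apply: openI; first exact: open_eball.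
  apply: openI; first exact: open_eball.
  have -> : [set z | eball x r (z + v)] = eball (x - v) r.
    by apply/seteqP; split => z; rewrite /eball /= opprB addrA (addrAC z).
  exact: open_eball.
have [|z [[yz [xz xzv]] Fz]] := Baire_countable odF _ oO.
  by exists y; split => //; rewrite /eball /= subrr enorm0.
have := Hd z yz; have := generic z Fz xz xzv.
by rewrite ltr_norml => ? /andP[_ ?]; lra.
Qed.

End MeanValue.

(** * Local expansion and local covering *)

Lemma compact_min (R : realType) n (K : set 'rV[R]_n) (g : 'rV[R]_n -> R) :
  K !=set0 -> compact K -> continuous g ->
  exists2 c, K c & forall y, K y -> g c <= g y.
Proof.
move=> K0 cK cg.
have [c /[!inE] Kc H] := EVT_min_rV K0 cK (continuous_subspaceT cg).
by exists c => // y Ky; apply: H; rewrite inE.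
Qed.

Lemma closed_eball_min (R : realType) n (x : 'rV[R]_n) r (g : 'rV[R]_n -> R) :
  0 <= r -> continuous g ->
  exists2 c, enorm (c - x) <= r & forall y, enorm (y - x) <= r -> g c <= g y.
Proof.
move=> r0; apply: (@compact_min _ _ [set y | enorm (y - x) <= r]).
  by exists x; rewrite /= subrr enorm0.
exact: compact_closed_eball.
Qed.

(** The vector [w] is the direction of the point [p] of the closure of [C] nearest to the origin. As
    [C] need not be closed, [p] is only approximated by points of [C]. *)
Lemma convex_separation (R : realType) n (C : set 'rV[R]_n) (d : R) : 0 < d ->
  C !=set0 ->
  (forall a b t, C a -> C b -> 0 <= t <= 1 -> C (t *: a + (1 - t) *: b)) ->
  (forall a, C a -> d <= enorm a) ->
  exists w, enorm w = 1 /\ forall a, C a -> d <= dot a w.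
Proof.
move=> d0 [c0 Cc0] convC dC.
pose K := [set y | enorm (y - 0) <= enorm c0] `&` closure C.
have [|||p [pc0 clp] pmin] := @compact_min R n K (@enorm R n).
- by exists c0; split; [rewrite /= subr0|exact: subset_closure].
- apply: compact_closedI; [exact: compact_closed_eball|exact: closed_closure].
- exact: enorm_continuous.
have approx e : 0 < e -> exists2 a, C a & enorm (a - p) < e.
  by move=> e0; have [a [Ca pa]] := clp _ (nbhs_eball p e0); exists a.
have pC a : C a -> enorm p <= enorm a.
  move=> Ca; have [ac0|/ltW c0a] := leP (enorm a) (enorm c0).
    by apply: pmin; split; [rewrite /= subr0|exact: subset_closure].
  by apply: le_trans c0a; move: pc0; rewrite /= subr0.
have dp : d <= enorm p.
  rewrite leNgt; apply/negP => pd; have [a Ca ap] := approx (d - enorm p) ltac:(lra).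
  by have := dC a Ca; have := enormB_le a p 0; rewrite !subr0; lra.
have p0 : 0 < enorm p by lra.
have step a t : C a -> 0 <= t <= 1 -> enorm p <= enorm (p + t *: (a - p)).
  move=> Ca t01; rewrite leNgt; apply/negP => lt.
  have [b Cb bp] := approx (enorm p - enorm (p + t *: (a - p))) ltac:(lra).
  have := pC _ (convC a b t Ca Cb t01).
  have -> : t *: a + (1 - t) *: b = (p + t *: (a - p)) + (1 - t) *: (b - p).
    by apply/rowP => i; rewrite !mxE; ring.
  have /andP[t0 t1] := t01.
  have := enormD (p + t *: (a - p)) ((1 - t) *: (b - p)).
  rewrite enormZ ger0_norm ?subr_ge0//.
  have : (1 - t) * enorm (b - p) <= enorm (b - p).
    by rewrite ler_piMl ?enorm_ge0//; lra.
  lra.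
have pa a : C a -> 0 <= dot p (a - p).
  move=> Ca; rewrite leNgt; apply/negP => neg.
  set u := a - p in neg; have u0 : 0 < dot u u.
    rewrite lt_def dot_ge0 dot_self expf_eq0 /= enorm_eq0 andbT.
    by apply: contraTneq neg => ->; rewrite dotC dot0l ltxx.
  (* The minimizer of the squared norm of [p + t *: u], truncated at 1 to remain on the segment. *)
  pose t := Num.min 1 (- dot p u / dot u u).
  have t0 : 0 < t by rewrite lt_min ltr01 divr_gt0// oppr_gt0.
  have t1 : t <= 1 by rewrite ge_min lexx.
  have tu : t * dot u u <= - dot p u.
    by rewrite -ler_pdivlMr// ge_min lexx orbT.
  have := step a t Ca; rewrite ltW// t1 => /(_ isT).
  rewrite -(@ler_pXn2r _ 2)// ?nnegrE ?enorm_ge0// -!dot_self -/u.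
  rewrite dotDl !dotDr !dotZl !dotZr (dotC u p).
  clearbody t; move: t0 tu neg; clear; nra.
exists ((enorm p)^-1 *: p); split.
  by rewrite enormZ gtr0_norm ?invr_gt0// mulVf// gt_eqF.
move=> a Ca; rewrite dotZr ler_pdivlMl//.
have := pa a Ca; rewrite dotBr dot_self (dotC p a).
by clear -dp p0; nra.
Qed.

Lemma convex_hull_convex (R : realType) (M : lmodType R) (S : set M) :
  convex_set (convex_hull S).
Proof.
move=> a b t /set_mem Sa /set_mem Sb; apply/mem_set => A [convA SA].
apply: set_mem; apply: (convA); apply/mem_set.
  exact: (Sa A (conj convA SA)).
exact: (Sb A (conj convA SA)).
Qed.

Lemma convex_hull_conv (R : realType) (M : lmodType R) (S : set M) a b (t : R) :
  convex_hull S a -> convex_hull S b -> 0 <= t <= 1 ->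
  convex_hull S (t *: a + (1 - t) *: b).
Proof.
move=> Sa Sb /andP[t0 t1].
have := @convex_hull_convex _ _ S a b (Itv01 t0 t1) (mem_set Sa) (mem_set Sb).
by move=> /set_mem.
Qed.

Lemma sub_convex_hull (R : realType) (M : lmodType R) (S : set M) :
  S `<=` convex_hull S.
Proof. exact: sub_gen_smallest. Qed.

(** The limit of a nonincreasing function at 0 from the right is its supremum, so some radius
    already exceeds [k]; homogeneity then removes the restriction to unit vectors. *)
Lemma nu_expanding (R : realType) n (f : 'rV[R]_n -> 'rV[R]_n) x (k c : R) :
  (c%:E <= nu f x)%E -> k < c ->
  exists2 r : R, 0 < r & forall A, convex_hull (jacobians f (eball x r)) A ->
    forall v, k * enorm v <= enorm (v *m A).
Proof.
move=> cnu kc.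
pose g r := ereal_inf [set sigma A | A in convex_hull (jacobians f (eball x r))].
have gmono : {in Interval (BRight 0) +oo%O &, nonincreasing_fun g}.
  move=> r s _ _ rs; apply: le_ereal_inf => _ [A hA <-]; exists A => //.
  apply: smallest_sub hA; first exact: convex_hull_convex.
  apply: subset_trans (@sub_convex_hull _ _ _) => _ [z [xz Cz] <-].
  by exists z => //; split => //; exact: lt_le_trans xz rs.
have gcvg := @nonincreasing_at_right_cvge R g 0 +oo%O isT gmono.
have : (k%:E < ereal_sup (g @` [set` Interval (BRight 0%R) +oo%O]))%E.
  rewrite -(cvg_lim _ gcvg)//; apply: lt_le_trans cnu; by rewrite lte_fin.
move=> /ereal_sup_gt[_ [r /= r0 <-] kg]; exists r.
  by move: r0; rewrite in_itv /= andbT.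
move=> A hA v.
have kA : (k%:E <= sigma A)%E.
  by apply: le_trans (ltW kg) _; apply: ereal_inf_lbound; exists A.
have [->|v0] := eqVneq v 0; first by rewrite mul0mx enorm0 mulr0.
rewrite -enorm_gt0 in v0.
have : (k%:E <= (enorm (((enorm v)^-1 *: v) *m A))%:E)%E.
  apply: le_trans kA _; apply: ereal_inf_lbound; exists ((enorm v)^-1 *: v) => //=.
  by rewrite enormZ gtr0_norm ?invr_gt0// mulVf// gt_eqF.
by rewrite lee_fin -scalemxAl enormZ gtr0_norm ?invr_gt0// mulrC ler_pdivlMr.
Qed.

Lemma dot_mulmx (R : realType) n (u v : 'rV[R]_n) (A : 'M[R]_n) :
  dot (v *m A) u = dot v (u *m A^T).
Proof.
have dotE (a b : 'rV[R]_n) : dot a b = (a *m b^T) ord0 ord0.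
  by rewrite mxE; apply: eq_bigr => i _; rewrite mxE.
by rewrite !dotE trmx_mul trmxK mulmxA.
Qed.

(** The matrices [A] and [A^T] have the same smallest singular value. Here [A] is invertible, and
    Cauchy-Schwarz bounds the square of [enorm e], the product of [e *m invmx A] with [e *m A^T]. *)
Lemma expanding_trmx (R : realType) n (A : 'M[R]_n) (k : R) : 0 < k ->
  (forall v, k * enorm v <= enorm (v *m A)) ->
  forall e, k * enorm e <= enorm (e *m A^T).
Proof.
move=> k0 kA e.
have Aunit : A \in unitmx.
  rewrite -row_free_unit -kermx_eq0; apply/eqP/row_matrixP => i; rewrite row0.
  apply/eqP; rewrite -enorm_eq0; apply/eqP/le_anti; rewrite enorm_ge0 andbT.
  have := kA (row i (kermx A)); rewrite -row_mul mulmx_ker row0 enorm0.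
  by rewrite pmulr_rle0.
have [->|e0] := eqVneq e 0; first by rewrite enorm0 mulr0 enorm_ge0.
rewrite -enorm_gt0 in e0.
have := kA (e *m invmx A); rewrite mulmxKV// => kE.
have : enorm e ^+ 2 <= enorm (e *m invmx A) * enorm (e *m A^T).
  by rewrite -dot_self -{1}(mulmxKV Aunit e) dot_mulmx dot_le.
have := enorm_ge0 (e *m invmx A); have := enorm_ge0 (e *m A^T).
move: kE e0 k0; set a := enorm e; set b := enorm _; set c := enorm (_ *m _^T).
move=> kE e0 k0 b0 c0 H.
have : a * (k * a) <= a * c.
  apply: (@le_trans _ _ (k * (b * c))); first by rewrite mulrCA -expr2 ler_pM2l.
  by rewrite mulrA ler_wpM2r.
by rewrite ler_pM2l.
Qed.

(** The vector [w] depends on [v] and not on [y], so the bound can be averaged over translates. *)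
Definition expanding_increments (R : realType) n (f : 'rV[R]_n -> 'rV[R]_n)
    (U : set 'rV[R]_n) (k : R) :=
  forall v, exists2 w, enorm w <= 1 & forall y, U y -> U (y + v) ->
    k * enorm v <= dot (f (y + v) - f y) w.

(* The statement dual to [expanding_increments], coming from the transposed
   derivatives: any error [e] can be reduced by moving in some direction [v]. *)
Definition covering_increments (R : realType) n (f : 'rV[R]_n -> 'rV[R]_n)
    (U : set 'rV[R]_n) (k : R) :=
  forall e, e != 0 -> exists2 v, enorm v = 1 &
    forall t, 0 <= t -> forall y, U y -> U (y + t *: v) ->
      t * (k * enorm e) <= dot (f (y + t *: v) - f y) e.

Section Increments.
Variables (R : realType) (D : forall n, set (set 'rV[R]_n)).
Arguments D : clear implicits.
Hypothesis hD : o_minimal D.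
Variables (n : nat) (f : 'rV[R]_n -> 'rV[R]_n).
Hypotheses (f_cont : continuous f) (f_def : definable_map D f).
Variables (x : 'rV[R]_n) (r k : R).
Hypotheses (r0 : 0 < r) (k0 : 0 < k).
Hypothesis kA : forall A, convex_hull (jacobians f (eball x r)) A ->
    forall v, k * enorm v <= enorm (v *m A).

(** Separation needs a point to start from; over an empty hull [kA] would be vacuous. *)
Let jac_nonempty : jacobians f (eball x r) !=set0.
Proof.
have [|y [xy Gy]] := int_strict_partial_dense hD f_cont f_def _ (@open_eball R n x r).
  by exists x; rewrite /eball /= subrr enorm0.
exists (jacobian f y), y => //; split => // nC; apply: nC.
exact: strict_partial_C1.
Qed.

Lemma expanding_incr : expanding_increments f (eball x r) k.
Proof.
move=> v; have [->|v0] := eqVneq v 0.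
  exists 0; first by rewrite enorm0 ler01.
  by move=> y _ _; rewrite enorm0 mulr0 addr0 subrr dot0l.
have [A0 JA0] := jac_nonempty.
have kv0 : 0 < k * enorm v by rewrite mulr_gt0// enorm_gt0.
have [|||w [w1 Hw]] := @convex_separation R n
  [set v *m A | A in convex_hull (jacobians f (eball x r))] _ kv0.
- by exists (v *m A0), A0 => //; exact: sub_convex_hull.
- move=> _ _ t [A hA <-] [B hB <-] t01.
  exists (t *: A + (1 - t) *: B); first exact: convex_hull_conv.
  by rewrite mulmxDr -!scalemxAr.
- by move=> _ [A hA <-]; exact: kA.
exists w; first by rewrite w1.
move=> y xy xyv; apply: (mean_value_ineq hD f_cont f_def xy xyv) => A JA.
by apply: Hw; exists A => //; exact: sub_convex_hull.
Qed.

Lemma covering_incr : covering_increments f (eball x r) k.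
Proof.
move=> e e0; have [A0 JA0] := jac_nonempty.
have ke0 : 0 < k * enorm e by rewrite mulr_gt0// enorm_gt0.
have [|||v [v1 Hv]] := @convex_separation R n
  [set e *m A^T | A in convex_hull (jacobians f (eball x r))] _ ke0.
- by exists (e *m A0^T), A0 => //; exact: sub_convex_hull.
- move=> _ _ t [A hA <-] [B hB <-] t01.
  exists (t *: A + (1 - t) *: B); first exact: convex_hull_conv.
  by rewrite linearD !linearZ /= mulmxDr -!scalemxAr.
- by move=> _ [A hA <-]; apply: expanding_trmx => //; exact: kA.
exists v => // t t0 y xy xyv.
apply: (mean_value_ineq hD f_cont f_def xy xyv) => A JA.
rewrite -scalemxAl dotZl ler_wpM2l// dot_mulmx dotC.
by apply: Hv; exists A => //; exact: sub_convex_hull.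
Qed.

End Increments.

Lemma expanding_norm (R : realType) n (f : 'rV[R]_n -> 'rV[R]_n) U k y z :
  expanding_increments f U k -> U y -> U z ->
  k * enorm (z - y) <= enorm (f z - f y).
Proof.
move=> /(_ (z - y))[w w1 /(_ y)]; rewrite subrKC => H Uy Uz.
apply: le_trans (H Uy Uz) _; apply: le_trans (dot_le _ _) _.
by rewrite ler_piMr ?enorm_ge0.
Qed.

(* At a nonzero minimum of [enorm (f z - q)], moving by [t *: v] decreases the
   squared distance at first order, the Lipschitz bound making the error
   quadratic in [t]. *)
Lemma lipschitz_covering (R : realType) n (f : 'rV[R]_n -> 'rV[R]_n) x r s k L q :
  continuous f -> 0 < k -> 0 < s < r ->
  expanding_increments f (eball x r) k -> covering_increments f (eball x r) k ->
  (forall y z, eball x r y -> eball x r z ->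
     enorm (f z - f y) <= L * enorm (z - y)) ->
  enorm (q - f x) < k * s / 2 ->
  exists2 y, enorm (y - x) <= s & f y = q.
Proof.
move=> f_cont k0 /andP[s0 sr] fexp fcov flip qfx.
have gcont : continuous (fun y => enorm (f y - q)).
  move=> z; apply: (@cvg_comp _ _ _ (fun z => f z - q) (@enorm R n)
    (nbhs z) (nbhs (f z - q))); last exact: enorm_continuous.
  by apply: (@cvgB _ _ _ (nbhs z)); [exact: f_cont|exact: cvg_cst].
have [y xy ymin] := closed_eball_min x (ltW s0) gcont.
exists y => //; apply/eqP; rewrite eq_sym -subr_eq0; apply/negP => /negP e0.
set e := q - f y in e0.
have inball z : enorm (z - x) <= s -> eball x r z by move=> xz; exact: le_lt_trans xz sr.
have xx : enorm (x - x) <= s by rewrite subrr enorm0 ltW.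
(* The minimum is interior: on the boundary sphere [f] is at distance at least [k * s] from [f x],
   hence farther from [q] than [f x] is. *)
have ys : enorm (y - x) < s.
  rewrite lt_neqAle xy andbT; apply/eqP => ys.
  have := expanding_norm fexp (inball x xx) (inball y xy); rewrite ys.
  have := ymin x xx; rewrite (enormC (f x)).
  have := enormB_le (f y) q (f x).
  by move: qfx; set a := k * s; lra.
have [v v1 Hv] := fcov e e0.
have en0 : 0 < enorm e by rewrite enorm_gt0.
(* The first term keeps [y + t *: v] in the ball. By the second, the quadratic error
   [L ^+ 2 * t ^+ 2] is below the linear gain [t * (k * enorm e)], strictly thanks to the [+ 1]. *)
pose t := Num.min ((s - enorm (y - x)) / 2) (k * enorm e / (L ^+ 2 + 1)).
have L1 : 0 < L ^+ 2 + 1 by rewrite ltr_wpDl ?sqr_ge0.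
have t0 : 0 < t by rewrite lt_min !divr_gt0 ?subr_gt0 ?mulr_gt0.
have ts : t <= (s - enorm (y - x)) / 2 by rewrite ge_min lexx.
have tL : t * (L ^+ 2 + 1) <= k * enorm e.
  by rewrite -ler_pdivlMr// ge_min lexx orbT.
have xyt : enorm (y + t *: v - x) <= s.
  rewrite addrAC; apply: le_trans (enormD _ _) _.
  by rewrite enormZ v1 mulr1 gtr0_norm//; lra.
have := Hv t (ltW t0) y (inball _ xy) (inball _ xyt).
have := flip y (y + t *: v) (inball _ xy) (inball _ xyt).
rewrite addrAC subrr add0r enormZ v1 mulr1 (gtr0_norm t0).
have := ymin _ xyt.
have -> : f (y + t *: v) - q = (f (y + t *: v) - f y) - e.
  by rewrite /e opprB addrA subrK.
set w := f _ - f y; rewrite (enormC (f y)) -/e => H1 H2 H3.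
have {}H1 : dot e e <= dot w w - dot w e - (dot w e - dot e e).
  have -> : dot w w - dot w e - (dot w e - dot e e) = dot (w - e) (w - e).
    by clearbody e w; rewrite dotBl !dotBr (dotC e w).
  by rewrite !dot_self ler_pXn2r ?nnegrE ?enorm_ge0.
have H4 : dot w w <= L ^+ 2 * t ^+ 2.
  have := enorm_ge0 w; rewrite dot_self -exprMn => w0.
  by rewrite ler_pXn2r ?nnegrE// (le_trans w0).
have : 0 < t * (k * enorm e) by rewrite !mulr_gt0.
have : t * (t * (L ^+ 2 + 1)) <= t * (k * enorm e) by rewrite ler_pM2l.
have : 0 < t ^+ 2 by rewrite exprn_gt0.
clearbody t; rewrite !expr2 in H4 *; clear -H1 H3 H4; nra.
Qed.

(** * Compactness, and smoothing by averages *)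

(** Radii are halved: for [y] within [r / 2] of [x] and [d < r / 2], the ball of radius [d] around
    [y] lies in that of radius [r] around [x]. *)
Lemma Lebesgue_number (R : realType) n (K : set 'rV[R]_n)
    (P : 'rV[R]_n -> R -> Prop) : compact K ->
  (forall x, K x -> exists2 r : R, 0 < r & P x r) ->
  exists2 d : R, 0 < d & forall y, K y ->
    exists x r, P x r /\ enorm (y - x) + d <= r.
Proof.
move=> /compact_near_coveringP cK HP.
have H : \forall d \near (0 : R)^'+, K `<=` [set y |
    exists x r, P x r /\ enorm (y - x) + d <= r].
  apply: cK => x Kx; have [r r0 Pxr] := HP x Kx.
  exists (eball x (r / 2), [set d : R | d < r / 2]).
    split; first by apply: nbhs_eball; rewrite divr_gt0.
    by apply: nbhs_right_lt; rewrite divr_gt0.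
  move=> [y d] /= [xy dr]; exists x, r; split => //.
  by move: xy; rewrite /eball /=; lra.
have [d [d0 Kd]] : exists d : R, 0 < d /\ K `<=` [set y |
    exists x r, P x r /\ enorm (y - x) + d <= r].
  have /filter_ex[d [Kd d0]] : \forall d \near (0 : R)^'+, K `<=` [set y |
    exists x r, P x r /\ enorm (y - x) + d <= r] /\ 0 < d.
    by near=> d; split; near: d => //; exact: nbhs_right_gt.
  by exists d.
by exists d.
Unshelve. all: by end_near. Qed.

Lemma Heine_eball (R : realType) m n (f : 'rV[R]_m -> 'rV[R]_n)
    (K : set 'rV[R]_m) (e : R) : continuous f -> compact K -> 0 < e ->
  exists2 d : R, 0 < d & forall y z, K y -> enorm (z - y) < d ->
    enorm (f z - f y) < e.
Proof.
move=> cf cK e0.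
have e2 : 0 < e / 2 by rewrite divr_gt0.
have [x _|d d0 Hd] := @Lebesgue_number _ _ K
    (fun x r => forall y, enorm (y - x) < r -> enorm (f y - f x) < e / 2) cK.
  have /nbhs_eballP[r r0 xr] : nbhs x [set y | enorm (f y - f x) < e / 2].
    by apply: (@enorm_cvgP _ _ _ (nbhs x) _ f (f x)).1 => //; exact: cf.
  by exists r => // y /xr.
exists d => // y z Ky yz; have [x [r [Hx xyd]]] := Hd y Ky.
have := enormB_le (f z) (f x) (f y); rewrite (enormC (f x)).
have := Hx y ltac:(have := enorm_ge0 (y - x); lra).
have := Hx z ltac:(have := enormB_le z y x; lra).
lra.
Qed.

Section Average.
Variable R : realType.
Implicit Types phi psi : R -> R.

(* The base point [-2] leaves room for translating [0, 1] by less than [1]. *)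
Definition primitive phi (t : R) : R := (\int[lebesgue_measure]_(s in `[(- 2)%R, t]) phi s)%R.

Definition average (w : R) phi := (primitive phi w - primitive phi 0) / w.

Lemma primitive_derive phi (t : R) : continuous phi -> -2 < t < 3 ->
  is_derive t 1 (primitive phi) (phi t).
Proof.
move=> cphi /andP[t2 t3].
have iphi : lebesgue_measure.-integrable `[(- 2)%R, 3] (EFin \o phi).
  apply: continuous_compact_integrable; first exact: segment_compact.
  exact: continuous_subspaceT.
have [dphi phiE] := continuous_FTC1_closed t3 iphi t2 (cphi t).
by apply: DeriveDef; [exact: dphi|rewrite -derive1E; exact: phiE].
Qed.

Lemma le_increment (phi psi F G : R -> R) (a b : R) : a <= b ->
  (forall t, a <= t <= b -> is_derive t 1 F (phi t)) ->
  (forall t, a <= t <= b -> is_derive t 1 G (psi t)) ->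
  (forall t, a <= t <= b -> phi t <= psi t) ->
  F b - F a <= G b - G a.
Proof.
move=> ab dF dG le.
have dGF t : a <= t <= b -> is_derive t 1 (G - F) (psi t - phi t).
  by move=> tab; apply: is_deriveB; [exact: dG|exact: dF].
have [t|t tab|c] := @MVT_segment _ (G - F) (fun t => psi t - phi t) a b ab.
- by move=> /[!in_itv]/= /andP[? ?]; apply: dGF; rewrite !ltW.
- apply: continuous_in_subspaceT => s /[!inE] /= /[!in_itv]/= sab.
  by apply: differentiable_continuous; apply/derivable1_diffP; case: (dGF s sab).
rewrite in_itv /= => /le psic; rewrite /= !fctE /=.
have : 0 <= (psi c - phi c) * (b - a) by rewrite mulr_ge0// subr_ge0.
by move=> H1 H2; lra.
Qed.

(** Any two primitives have equal increments, by comparison both ways. Rules for averages then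
    reduce to exhibiting a primitive. *)
Lemma average_ext (w : R) (phi F : R -> R) : 0 < w <= 1 -> continuous phi ->
  (forall t, 0 <= t <= w -> is_derive t 1 F (phi t)) ->
  average w phi = (F w - F 0) / w.
Proof.
move=> /andP[w0 w1] cphi dF; congr (_ / w); apply/le_anti/andP.
have dP t : 0 <= t <= w -> is_derive t 1 (primitive phi) (phi t).
  by move=> /andP[? ?]; apply: primitive_derive => //; apply/andP; split; lra.
by split; apply: (@le_increment phi phi) => //; exact: ltW.
Qed.

Lemma le_average (w : R) phi psi : 0 < w <= 1 -> continuous phi -> continuous psi ->
  (forall t, 0 <= t <= w -> phi t <= psi t) -> average w phi <= average w psi.
Proof.
move=> /andP[w0 w1] cphi cpsi H; rewrite /average ler_pM2r ?invr_gt0//.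
apply: (@le_increment phi psi) => //; first exact: ltW.
  by move=> t /andP[? ?]; apply: primitive_derive => //; apply/andP; split; lra.
by move=> t /andP[? ?]; apply: primitive_derive => //; apply/andP; split; lra.
Qed.

Lemma average_cst (w c : R) : 0 < w <= 1 -> average w (fun=> c) = c.
Proof.
move=> w01; have /andP[w0 w1] := w01.
have cc : continuous (fun _ : R => c) by move=> t; exact: cvg_cst.
have dF (t : R) : 0 <= t <= w -> is_derive t 1 (fun t => c * t) c.
  move=> _; have := @is_deriveZ _ _ _ id c t 1 1 (is_derive_id t 1).
  by rewrite [c *: 1]mulr1.
by rewrite (average_ext w01 cc dF) mulr0 subr0 mulfK// gt_eqF.
Qed.

Lemma averageDc (w c : R) phi : 0 < w <= 1 -> continuous phi ->
  average w (fun t => phi t + c) = average w phi + c.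
Proof.
move=> w01 cphi; have /andP[w0 w1] := w01.
have cc : continuous (fun t : R => phi t + c).
  by move=> t; apply: cvgD; [exact: cphi|exact: cvg_cst].
have dF (t : R) : 0 <= t <= w ->
    is_derive t 1 (primitive phi + (fun t => c * t)) (phi t + c).
  move=> /andP[t0 tw]; apply: is_deriveD.
    by apply: primitive_derive => //; apply/andP; split; lra.
  have := @is_deriveZ _ _ _ id c t 1 1 (is_derive_id t 1).
  by rewrite [c *: 1]mulr1.
rewrite (average_ext w01 cc dF) /average !fctE mulr0 addr0.
by field; rewrite gt_eqF.
Qed.

Lemma average_sum (w : R) n (phi : 'I_n -> R -> R) (a : 'I_n -> R) : 0 < w <= 1 ->
  (forall i, continuous (phi i)) ->
  continuous (fun t : R => \sum_i phi i t * a i) ->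
  average w (fun t => \sum_i phi i t * a i) = \sum_i average w (phi i) * a i.
Proof.
move=> w01 cphi cc; have /andP[w0 w1] := w01.
have dF (t : R) : 0 <= t <= w ->
    is_derive t 1 (\sum_i (a i *: primitive (phi i))) (\sum_i phi i t * a i).
  move=> /andP[t0 tw].
  have -> : \sum_i phi i t * a i = \sum_i a i *: phi i t.
    by apply: eq_bigr => i _; exact: mulrC.
  apply: is_derive_sum => i; apply: is_deriveZ.
  by apply: primitive_derive => //; apply/andP; split; lra.
rewrite (average_ext w01 cc dF).
rewrite !fct_sumE -sumrB mulr_suml; apply: eq_bigr => i _.
rewrite /average -[(_ *: _) w]/(a i * primitive (phi i) w).
by rewrite -[(_ *: _) 0]/(a i * primitive (phi i) 0); ring.
Qed.

(** Shifting the window by [h] changes the integral only over two end intervals of length [|h|]. For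
    [|h| >= 1], beyond the reach of [primitive], the bound is trivial since [w <= 1]. *)
Lemma average_shift w phi M h : 0 < w <= 1 -> continuous phi ->
  (forall t, `|phi t| <= M) ->
  `|average w (fun t => phi (t + h)) - average w phi| <= 2 * M / w * `|h|.
Proof.
move=> w01 cphi phiM; have /andP[w0 w1] := w01.
have M0 : 0 <= M by apply: le_trans (phiM 0).
have cphih : continuous (fun t => phi (t + h)).
  move=> t; apply: (@cvg_comp _ _ _ (fun t => t + h) phi (nbhs t) (nbhs (t + h))).
    by apply: cvgD; [exact: cvg_id|exact: cvg_cst].
  exact: cphi.
have cM c : continuous (fun _ : R => c : R) by move=> t; exact: cvg_cst.
have avM psi : continuous psi -> (forall t, `|psi t| <= M) -> `|average w psi| <= M.
  move=> cpsi psiM.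
  have psib t : - M <= psi t <= M by rewrite -ler_norml.
  have := le_average w01 (cM (- M)) cpsi (fun t _ => proj1 (andP (psib t))).
  have := le_average w01 cpsi (cM M) (fun t _ => proj2 (andP (psib t))).
  by rewrite !average_cst// ler_norml => -> ->.
have Mw : M <= M / w by rewrite ler_pdivlMr// ler_piMr.
have [h1|h1] := leP 1 `|h|.
  apply: le_trans (ler_normB _ _) _.
  have := avM _ cphi phiM; have := avM _ cphih (fun t => phiM (t + h)).
  have : 2 * M / w * 1 <= 2 * M / w * `|h|.
    by apply: ler_wpM2l => //; rewrite divr_ge0 ?mulr_ge0// ltW.
  by rewrite mulr1 -mulrA; lra.
have [hl hr] : -1 < h /\ h < 1 by move: h1; rewrite ltr_norml => /andP[].
have dF (t : R) : 0 <= t <= w ->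
    is_derive t 1 (primitive phi \o shift h) (phi (t + h)).
  move=> /andP[t0 tw]; rewrite -[phi _]mulr1; apply: is_derive1_comp.
    by apply: primitive_derive => //; apply/andP; split; rewrite /=; lra.
  exact: is_derive_shift.
rewrite (average_ext w01 cphih dF) /average /= add0r -mulrBl normrM.
rewrite [`|w^-1|]gtr0_norm ?invr_gt0// mulrAC ler_pM2r ?invr_gt0//.
have incr (a b : R) : -2 < a -> a <= b -> b < 3 ->
    `|primitive phi b - primitive phi a| <= M * (b - a).
  move=> a2 ab b3; rewrite ler_norml.
  have dP (t : R) : a <= t <= b -> is_derive t 1 (primitive phi) (phi t).
    by move=> /andP[? ?]; apply: primitive_derive => //; apply/andP; split; lra.
  have dL (c t : R) : is_derive t 1 (fun t => c * t) c.
    have := @is_deriveZ _ _ _ id c t 1 1 (is_derive_id t 1).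
    by rewrite [c *: 1]mulr1.
  have phib t : - M <= phi t <= M by rewrite -ler_norml.
  have := le_increment ab dP (fun t _ => dL M t) (fun t _ => proj2 (andP (phib t))).
  have := le_increment ab (fun t _ => dL (- M) t) dP (fun t _ => proj1 (andP (phib t))).
  by move=> H1 H2; apply/andP; split; lra.
have incr2 (a : R) : -1 < a < 2 -> `|primitive phi (a + h) - primitive phi a| <= M * `|h|.
  move=> /andP[a1 a2]; have [h0|h0] := leP 0 h.
    have := incr a (a + h) ltac:(lra) ltac:(lra) ltac:(lra).
    have -> : a + h - a = h by ring.
    by rewrite (ger0_norm h0).
  have := incr (a + h) a ltac:(lra) ltac:(lra) ltac:(lra).
  by rewrite distrC (ltr0_norm h0); have -> : a - (a + h) = - h by ring.
have := incr2 w ltac:(apply/andP; split; lra).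
have := incr2 0 ltac:(apply/andP; split; lra); rewrite add0r.
move=> H1 H2.
have -> : primitive phi (w + h) - primitive phi h - (primitive phi w - primitive phi 0)
  = (primitive phi (w + h) - primitive phi w) - (primitive phi h - primitive phi 0).
  by ring.
by apply: le_trans (ler_normB _ _) _; lra.
Qed.

End Average.

Section Smoothing.
Variables (R : realType) (n : nat) (w M : R).
Hypothesis w01 : 0 < w <= 1.
Implicit Types (f : 'rV[R]_n -> 'rV[R]_n) (y z u : 'rV[R]_n).

Let w0 : 0 < w. Proof. by case/andP: w01. Qed.

Definition dir_average (i : 'I_n) f : 'rV[R]_n -> 'rV[R]_n := fun y =>
  \row_j average w (fun s => f (y + s *: delta_mx ord0 i) ord0 j).

Definition ucont f := forall e : R, 0 < e -> exists2 d : R, 0 < d &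
  forall y z, enorm (z - y) < d -> enorm (f z - f y) < e.

Lemma ucont_continuous f : ucont f -> continuous f.
Proof.
move=> uf y; apply: (@enorm_cvgP _ _ _ (nbhs y) _ f (f y)).2 => e /uf[d d0 Hd].
by apply/nbhs_eballP; exists d => // z; exact: Hd.
Qed.

Section OneDirection.
Variables (i : 'I_n) (f : 'rV[R]_n -> 'rV[R]_n).
Hypotheses (f_cont : continuous f) (fM : forall y, enorm (f y) <= M).

Lemma dot_dir_average y u :
  dot (dir_average i f y) u = average w (fun s => dot (f (y + s *: delta_mx ord0 i)) u).
Proof.
rewrite /dot [RHS]average_sum//.
- by apply: eq_bigr => j _; rewrite mxE.
- move=> j; rewrite (_ : (fun _ => _) =
    fun s : R => dot (f (y + s *: delta_mx ord0 i)) (delta_mx ord0 j)).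
    exact: line_continuous.
  by apply/funext => s; rewrite coord_dot.
- exact: line_continuous.
Qed.

Lemma dir_average_le y z u al :
  (forall s, 0 <= s <= w -> al <= dot (f (y + s *: delta_mx ord0 i) -
     f (z + s *: delta_mx ord0 i)) u) ->
  al <= dot (dir_average i f y - dir_average i f z) u.
Proof.
move=> H; rewrite dotBl !dot_dir_average lerBrDl -averageDc//; last exact: line_continuous.
apply: le_average => //.
- move=> t; apply: cvgD; [exact: line_continuous|exact: cvg_cst].
- exact: line_continuous.
- by move=> s /H; rewrite dotBl lerBrDl.
Qed.

(** Closed balls are convex; this is tested on the scalar product with the deviation itself, which
    reduces it to averages of real functions. *)
Lemma dir_average_near y u c :
  (forall s, 0 <= s <= w -> enorm (f (y + s *: delta_mx ord0 i) - u) <= c) ->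
  enorm (dir_average i f y - u) <= c.
Proof.
move=> H; have [->|e0] := eqVneq (dir_average i f y - u) 0.
  by rewrite enorm0; apply: le_trans (enorm_ge0 _) (H 0 _); rewrite lexx ltW.
set e := dir_average i f y - u in e0 *; rewrite -enorm_gt0 in e0.
have : dot (dir_average i f y) e <= dot u e + c * enorm e.
  rewrite dot_dir_average -(average_cst (_ + _) w01); apply: le_average => //.
  - exact: line_continuous.
  - by move=> t; exact: cvg_cst.
  - move=> s /H Hs; rewrite -lerBlDl -dotBl; apply: le_trans (dot_le _ _) _.
    by rewrite ler_pM2r.
by rewrite -lerBlDl -dotBl -/e dot_self expr2 ler_pM2r.
Qed.

Lemma dir_average_lipschitz y h :
  enorm (dir_average i f (y + h *: delta_mx ord0 i) - dir_average i f y) <=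
  2 * M / w * `|h|.
Proof.
have M0 : 0 <= M by apply: le_trans (enorm_ge0 _) (fM 0).
set e := _ - _; have [->|e0] := eqVneq e 0.
  by rewrite enorm0 mulr_ge0// divr_ge0 ?mulr_ge0// ltW.
rewrite -enorm_gt0 in e0.
have H : `|average w (fun t => dot (f (y + (t + h) *: delta_mx ord0 i)) e) -
    average w (fun t => dot (f (y + t *: delta_mx ord0 i)) e)| <=
    2 * (M * enorm e) / w * `|h|.
  apply: (@average_shift _ w (fun t => dot (f (y + t *: delta_mx ord0 i)) e)) => //.
    exact: line_continuous.
  move=> t; rewrite ler_norml lerNl -dotNl; apply/andP.
  by split; apply: le_trans (dot_le _ _) _; rewrite ?enormN ler_pM2r.
have : dot e e <= 2 * (M * enorm e) / w * `|h|.
  apply: le_trans (le_trans (ler_norm _) H).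
  rewrite {1}/e dotBl !dot_dir_average.
  have -> : (fun s => dot (f (y + h *: delta_mx ord0 i + s *: delta_mx ord0 i)) e) =
    (fun s => dot (f (y + (s + h) *: delta_mx ord0 i)) e).
    by apply/funext => s; rewrite -addrA -scalerDl addrC (addrC s) addrC.
  exact: lexx.
rewrite dot_self expr2 => H2; rewrite -(ler_pM2r e0); apply: le_trans H2 _.
by rewrite le_eqVlt; apply/orP; left; apply/eqP; ring.
Qed.

End OneDirection.

Lemma dir_average_ucont i f : ucont f -> ucont (dir_average i f).
Proof.
move=> uf e e0; have fc := ucont_continuous uf.
have e2 : 0 < e / 2 by rewrite divr_gt0.
have [d d0 Hd] := uf _ e2; exists d => // y z yz.
apply: (@le_lt_trans _ _ (e / 2)); last by lra.
set u := _ - _; have [->|u0] := eqVneq u 0; first by rewrite enorm0 ltW.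
rewrite -enorm_gt0 in u0; rewrite -(ler_pM2r u0).
have : - (e / 2 * enorm u) <= dot (dir_average i f z - dir_average i f y) (- u).
  apply: dir_average_le => // s _.
  rewrite dotC dotNl lerN2 dotC; apply: le_trans (dot_le _ _) _.
  by rewrite ler_pM2r// ltW// Hd// opprD addrACA subrr addr0.
by rewrite -/u dotC dotNl dot_self lerN2 expr2.
Qed.

(** The mean over the cube [y + [0, w]^n], obtained from one-dimensional averages. *)
Definition smooth f : 'rV[R]_n -> 'rV[R]_n := foldr dir_average f (enum 'I_n).

Lemma foldr_average f (s : seq 'I_n) : ucont f -> (forall y, enorm (f y) <= M) ->
  let F := foldr dir_average f s in
  [/\ ucont F, forall y, enorm (F y) <= M,
   forall y z u al, (forall p, enorm p <= w *+ size s ->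
     al <= dot (f (y + p) - f (z + p)) u) -> al <= dot (F y - F z) u,
   forall y u c, (forall p, enorm p <= w *+ size s -> enorm (f (y + p) - u) <= c) ->
     enorm (F y - u) <= c &
   forall i, i \in s -> forall y h,
     enorm (F (y + h *: delta_mx ord0 i) - F y) <= 2 * M / w * `|h| ].
Proof.
move=> uf fM /=; elim: s => [|j s [uF FM Fle Fnear Flip]] /=.
  split => //.
  - by move=> y z u al /(_ 0); rewrite !addr0; apply; rewrite enorm0.
  - by move=> y u c /(_ 0); rewrite addr0; apply; rewrite enorm0.
set F := foldr _ _ _ in uF FM Fle Fnear Flip *; have Fc := ucont_continuous uF.
have norm_delta t : 0 <= t <= w -> enorm (t *: delta_mx ord0 j : 'rV[R]_n) <= w.
  move=> /andP[t0 tw]; rewrite enormZ ger0_norm//.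
  have -> : enorm (delta_mx ord0 j : 'rV[R]_n) = 1.
    by rewrite enormE -coord_dot mxE !eqxx sqrtr1.
  by rewrite mulr1.
have norm_sum t p : 0 <= t <= w -> enorm p <= w *+ size s ->
    enorm (t *: delta_mx ord0 j + p) <= w *+ (size s).+1.
  move=> tw pw; apply: le_trans (enormD _ _) _; rewrite mulrS.
  by apply: lerD => //; exact: norm_delta.
split.
- exact: dir_average_ucont.
- move=> y; rewrite -[dir_average _ _ _]subr0; apply: dir_average_near => // t _.
  by rewrite subr0.
- move=> y z u al H; apply: dir_average_le => // t t01; apply: Fle => p pw.
  by rewrite -!addrA; apply: H; exact: norm_sum.
- move=> y u c H; apply: dir_average_near => // t t01; apply: Fnear => p pw.
  by rewrite -addrA; apply: H; exact: norm_sum.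
move=> i; rewrite inE => /orP[/eqP ->|si] y h; first exact: dir_average_lipschitz.
set e := _ - _; have M0 : 0 <= M by apply: le_trans (enorm_ge0 _) (fM 0).
have [->|e0] := eqVneq e 0.
  by rewrite enorm0 mulr_ge0// divr_ge0 ?mulr_ge0// ltW.
rewrite -enorm_gt0 in e0; rewrite -(ler_pM2r e0).
have : - (2 * M / w * `|h| * enorm e) <= dot e (- e).
  apply: dir_average_le => // t _.
  rewrite dotC dotNl lerN2 dotC; apply: le_trans (dot_le _ _) _.
  by rewrite ler_pM2r// addrAC; exact: Flip.
by rewrite dotC dotNl dot_self lerN2 expr2.
Qed.

(** One factor [n] counts the coordinates of the value, the other the steps of the coordinate path
    from [y] to [z]. *)
Lemma smooth_lipschitz f : ucont f -> (forall y, enorm (f y) <= M) ->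
  forall y z, enorm (smooth f z - smooth f y) <= 2 * M / w * n%:R * n%:R * enorm (z - y).
Proof.
move=> uf fM y z.
have [_ _ _ _ lip] := foldr_average (enum 'I_n) uf fM.
have M0 : 0 <= M by apply: le_trans (enorm_ge0 _) (fM 0).
have Mw : 0 <= 2 * M / w by rewrite divr_ge0 ?mulr_ge0// ltW.
apply: le_trans (enorm_le_sum _) _.
rewrite (_ : _ * _ = \sum_(j < n) (2 * M / w * n%:R * enorm (z - y))); last first.
  by rewrite sumr_const card_ord -[RHS]mulr_natr; ring.
apply: ler_sum => j _.
have := @coord_path R n (fun y => smooth f y ord0 j) y z
  (fun i => 2 * M / w * `|z ord0 i - y ord0 i|) _.
rewrite !mxE => H; apply: le_trans (H _) _.
  move=> i v _ _.
  have := coord_le_enorm (smooth f (v + (z ord0 i - y ord0 i) *: delta_mx ord0 i) -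
    smooth f v) j.
  rewrite !mxE => /le_trans; apply; apply: lip; exact: mem_enum.
rewrite -mulr_sumr -[leRHS]mulrA; apply: ler_wpM2l => //.
apply: (@le_trans _ _ (\sum_(i < n) enorm (z - y))).
  by apply: ler_sum => i _; have := coord_le_enorm (z - y) i; rewrite !mxE.
by rewrite sumr_const card_ord mulr_natl.
Qed.

End Smoothing.

Definition clamp (R : realType) (l h a : R) := Num.max l (Num.min h a).

Lemma clamp_dist (R : realType) (l h a b : R) :
  `|clamp l h a - clamp l h b| <= `|a - b|.
Proof.
wlog ab : a b / b <= a.
  by move=> H; case/orP: (le_total b a) => /H //; rewrite distrC (distrC b).
have min_ab : Num.min h b <= Num.min h a.
  by rewrite le_min !ge_min lexx ab orbT.
have max_ab : clamp l h b <= clamp l h a by rewrite /clamp ge_max !le_max lexx min_ab orbT.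
rewrite !ger0_norm ?subr_ge0//; apply: (@le_trans _ _ (Num.min h a - Num.min h b)).
  rewrite /clamp; case: (leP l (Num.min h a)); case: (leP l (Num.min h b)) => ? ?; lra.
case: (leP h a); case: (leP h b) => ? ?; lra.
Qed.

Lemma clamp_id (R : realType) (l h a : R) : l <= a <= h -> clamp l h a = a.
Proof. by move=> /andP[la ah]; rewrite /clamp min_r// max_r. Qed.

Lemma clamp_itv (R : realType) (l h a : R) : l <= h -> l <= clamp l h a <= h.
Proof. by move=> lh; rewrite /clamp le_max lexx ge_max lh ge_min lexx. Qed.

Lemma enorm_le_abs (R : realType) n (u v : 'rV[R]_n) :
  (forall i, `|u ord0 i| <= `|v ord0 i|) -> enorm u <= enorm v.
Proof.
move=> uv; apply: ler_wsqrtr; apply: ler_sum => i _.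
by rewrite -(real_normK (num_real (u _ _))) -(real_normK (num_real (v _ _))) ler_pXn2r ?nnegrE.
Qed.

(* Averages of [f] inherit its increment bounds, which are linear in [f], and are
   Lipschitz; they cover by [lipschitz_covering], and so does their limit [f]. *)
Lemma local_covering (R : realType) n (f : 'rV[R]_n -> 'rV[R]_n)
    (x q : 'rV[R]_n) (r s k : R) :
  continuous f -> 0 < k -> 0 < s < r ->
  expanding_increments f (eball x r) k -> covering_increments f (eball x r) k ->
  enorm (q - f x) < k * s / 2 ->
  exists2 y, enorm (y - x) <= s & f y = q.
Proof.
move=> f_cont k0 /andP[s0 sr] fexp fcov qfx.
have r0 : 0 < r by lra.
(* Composition with the retraction onto the circumscribed cube makes [f] bounded and uniformly
   continuous everywhere, without changing it on the ball. *)
pose cl (y : 'rV[R]_n) : 'rV[R]_n :=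
  \row_i clamp (x ord0 i - r) (x ord0 i + r) (y ord0 i).
have lh i : x ord0 i - r <= x ord0 i + r by lra.
have cl_dist y z : enorm (cl y - cl z) <= enorm (y - z).
  by apply: enorm_le_abs => i; rewrite !mxE; exact: clamp_dist.
have cl_id y : eball x r y -> cl y = y.
  move=> xy; apply/rowP => i; rewrite mxE clamp_id//.
  have := le_lt_trans (coord_le_enorm (y - x) i) xy.
  by rewrite !mxE ltr_norml => /andP[? ?]; apply/andP; split; lra.
pose K := [set y : 'rV[R]_n | enorm (y - x) <= \sum_(i < n) r].
have clK y : K (cl y).
  rewrite /K /=; apply: le_trans (enorm_le_sum _) _; apply: ler_sum => i _.
  rewrite !mxE ler_norml; have /andP[? ?] := clamp_itv (y ord0 i) (lh i).
  by apply/andP; split; lra.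
have cK : compact K by exact: compact_closed_eball.
pose g y := f (cl y).
have g_ucont : ucont g.
  move=> e e0; have [d d0 Hd] := Heine_eball f_cont cK e0.
  by exists d => // y z yz; apply: Hd => //; exact: le_lt_trans (cl_dist _ _) yz.
have [M gM] : exists M, forall y, enorm (g y) <= M.
  have K0 : K !=set0 by exists x; rewrite /K /= subrr enorm0; apply: sumr_ge0 => i _; exact: ltW.
  have nc : continuous (fun y => - enorm (f y)).
    move=> y; apply: (@cvgN _ _ _ (nbhs y)).
    apply: (@cvg_comp _ _ _ f (@enorm R n) (nbhs y) (nbhs (f y))); first exact: f_cont.
    exact: enorm_continuous.
  have [c _ Hc] := compact_min K0 cK nc.
  by exists (enorm (f c)) => y; rewrite -lerN2; exact: Hc.
pose r' := (s + r) / 2; have r's : s < r' by rewrite /r'; lra.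
have r'r : r' < r by rewrite /r'; lra.
suff near_sol (e : R) : 0 < e -> exists2 y, enorm (y - x) <= s & enorm (f y - q) <= e.
  have gcont : continuous (fun y => enorm (f y - q)).
    move=> z; apply: (@cvg_comp _ _ _ (fun z => f z - q) (@enorm R n)
      (nbhs z) (nbhs (f z - q))); last exact: enorm_continuous.
    by apply: (@cvgB _ _ _ (nbhs z)); [exact: f_cont|exact: cvg_cst].
  have [y xy ymin] := closed_eball_min x (ltW s0) gcont.
  exists y => //; apply/eqP; rewrite -subr_eq0 -enorm_eq0.
  apply/negP => /negP fq; have fq0 : 0 < enorm (f y - q) by rewrite lt_def fq enorm_ge0.
  have [z xz] := near_sol (enorm (f y - q) / 2) (divr_gt0 fq0 (ltr0Sn _ _)).
  by have := ymin z xz; lra.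
move=> e0.
(* Closeness [e'] serves twice: a solution for the average solves for [f] up to [e], and [q] remains
   within the covered radius. *)
pose e' := Num.min e ((k * s / 2 - enorm (q - f x)) / 2).
have e'0 : 0 < e' by rewrite lt_min e0 divr_gt0// subr_gt0.
have e'e : e' <= e by rewrite ge_min lexx.
have e'q : e' <= (k * s / 2 - enorm (q - f x)) / 2 by rewrite ge_min lexx orbT.
have [d d0 Hd] := g_ucont _ e'0.
(* Translations of size [w *+ n] change [g] by less than [e'] and keep the ball of radius [r']
   inside that of radius [r]. *)
pose w := Num.min 1 (Num.min d (r - r') / n.+2%:R).
have m0 : 0 < Num.min d (r - r') by rewrite lt_min d0 subr_gt0.
have w0 : 0 < w by rewrite lt_min ltr01 divr_gt0.
have w01 : 0 < w <= 1 by rewrite w0 ge_min lexx.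
have wn : w *+ n < Num.min d (r - r').
  rewrite -mulr_natr; have : w <= Num.min d (r - r') / n.+2%:R.
    by rewrite ge_min lexx orbT.
  rewrite ler_pdivlMr// => /(lt_le_trans _); apply.
  by rewrite ltr_pM2l// ltr_nat.
have wd : w *+ n < d by apply: lt_le_trans wn _; rewrite ge_min lexx.
have wr : w *+ n < r - r' by apply: lt_le_trans wn _; rewrite ge_min lexx orbT.
have [FU _ Fle Fnear _] := foldr_average w01 (enum 'I_n) g_ucont gM.
rewrite size_enum_ord -/(smooth w g) in FU Fle Fnear.
set F := smooth w g in FU Fle Fnear.
have Fg y : enorm (F y - g y) <= e'.
  apply: Fnear => p pw; apply: ltW; apply: Hd; rewrite addrAC subrr add0r.
  exact: le_lt_trans wd.
have ballp y p : eball x r' y -> enorm p <= w *+ n -> eball x r (y + p).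
  rewrite /eball /= => xy pw; rewrite addrAC.
  by apply: le_lt_trans (enormD _ _) _; lra.
have Fincr y v u al : eball x r' y -> eball x r' (y + v) ->
    (forall z, eball x r z -> eball x r (z + v) -> al <= dot (f (z + v) - f z) u) ->
    al <= dot (F (y + v) - F y) u.
  move=> xy xyv H; apply: Fle => p pw; rewrite /g !cl_id; try exact: ballp.
  by rewrite addrAC; apply: H; [exact: ballp|rewrite addrAC; exact: ballp].
have Fexp : expanding_increments F (eball x r') k.
  move=> v; have [u u1 Hu] := fexp v; exists u => // y xy xyv.
  exact: Fincr.
have Fcov : covering_increments F (eball x r') k.
  move=> u u0; have [v v1 Hv] := fcov u u0; exists v => // t t0 y xy xyv.
  by apply: Fincr => // z; exact: Hv.
have xx : eball x r x by rewrite /eball /= subrr enorm0.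
have qFx : enorm (q - F x) < k * s / 2.
  have := enormB_le q (g x) (F x); have := Fg x; rewrite (enormC (F x)).
  have -> : g x = f x by rewrite /g cl_id.
  lra.
have sr' : 0 < s < r' by rewrite s0.
have [y xy Fyq] := lipschitz_covering (ucont_continuous FU) k0 sr' Fexp Fcov
  (fun y z _ _ => smooth_lipschitz w01 g_ucont gM y z) qFx.
exists y => //; apply: le_trans e'e.
have := Fg y; rewrite Fyq enormC /g cl_id//; exact: le_lt_trans sr.
Qed.

(** * Lifting segments *)

Section SubPrimitive.
Variables (R : realType) (c : R -> R).
Hypothesis c0 : forall t, 0 <= t -> 0 < c t.

(* Satisfied by the piecewise linear primitive of a lower Darboux sum of [c];
   unlike [c] and its own primitive, it controls slopes at every point. *)
Definition sub_primitive (a b L : R) (F : R -> R) :=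
  [/\ F a = 0, F b = L & forall x, a <= x <= b ->
    exists2 k, 0 < k < c x & exists2 d, 0 < d & forall y, a <= y <= b ->
      `|y - x| < d -> `|F y - F x| <= k * `|y - x|].

Lemma sub_primitive_point a : 0 <= a -> sub_primitive a a 0 (fun=> 0).
Proof.
move=> a0; split => // x /andP[ax xa].
have cx : 0 < c x by apply: c0; exact: le_trans ax.
exists (c x / 2); first by apply/andP; split; lra.
by exists 1 => // y _ _; rewrite subrr normr0 mulr_ge0// divr_ge0 ?ltW.
Qed.

Lemma sub_primitive_linear a b m : 0 <= a -> 0 <= m ->
  (forall x, a <= x <= b -> m < c x) ->
  sub_primitive a b (m * (b - a)) (fun x => m * (x - a)).
Proof.
move=> a0 m0 mc; split; rewrite ?subrr ?mulr0// => x xab.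
have cx : 0 < c x by apply: c0; case/andP: xab => ax _; exact: le_trans ax.
(* [m] may be 0, while the slope has to be positive. *)
exists (Num.max m (c x / 2)).
  by rewrite lt_max gt_max mc// divr_gt0 ?orbT//=; lra.
exists 1 => // y _ _; rewrite -mulrBr (_ : y - a - (x - a) = y - x); last by ring.
by rewrite normrM (ger0_norm m0) ler_wpM2r// le_max lexx.
Qed.

(** [F] is frozen after [b] and [F'] before it; at [b] the larger of the two slopes serves both
    sides. *)
Lemma sub_primitive_cat a b e L L' F F' : a <= b -> b <= e ->
  sub_primitive a b L F -> sub_primitive b e L' F' ->
  sub_primitive a e (L + L') (fun x => F (Num.min x b) + F' (Num.max x b)).
Proof.
move=> ab be [Fa Fb HF] [F'b F'e HF']; split.
- by rewrite min_l// max_r// Fa F'b addr0.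
- by rewrite min_r// max_l// Fb F'e.
move=> x /andP[ax xe]; have [xb|bx|xb] := ltgtP x b.
- have [|k kc [d d0 Hd]] := HF x; first by rewrite ax ltW.
  exists k => //; exists (Num.min d (b - x)); first by rewrite lt_min d0 subr_gt0.
  move=> y /andP[ay ye]; rewrite lt_min => /andP[yd yx].
  have yb : y < b by move: yx; rewrite ltr_norml => /andP[_ ?]; lra.
  rewrite (min_l (ltW yb)) (max_r (ltW yb)).
  by rewrite opprD addrACA subrr addr0; apply: Hd => //; rewrite ay ltW.
- have [|k kc [d d0 Hd]] := HF' x; first by rewrite xe ltW.
  exists k => //; exists (Num.min d (x - b)); first by rewrite lt_min d0 subr_gt0.
  move=> y /andP[ay ye]; rewrite lt_min => /andP[yd yx].
  have yb : b < y by move: yx; rewrite ltr_norml => /andP[? _]; lra.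
  rewrite (min_r (ltW yb)) (max_l (ltW yb)).
  by rewrite opprD addrACA subrr add0r; apply: Hd => //; rewrite ye ltW.
subst x.
have [|k /andP[k0 kc] [d d0 Hd]] := HF b; first by rewrite ab lexx.
have [|k' /andP[k'0 kc'] [d' d'0 Hd']] := HF' b; first by rewrite be lexx.
exists (Num.max k k'); first by rewrite lt_max gt_max k0 kc kc'.
exists (Num.min d d'); first by rewrite lt_min d0.
move=> y /andP[ay ye]; rewrite lt_min => /andP[yd yd'].
have [yb|by_] := leP y b.
  rewrite opprD addrACA subrr addr0; apply: le_trans (Hd _ _ yd) _; first by rewrite ay.
  by rewrite ler_wpM2r// le_max lexx.
rewrite opprD addrACA subrr add0r; apply: le_trans (Hd' _ _ yd') _.
  by rewrite ye ltW.
by rewrite ler_wpM2r// le_max lexx orbT.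
Qed.

Lemma near_inf a b (e : R) : 0 <= a -> a <= b -> 0 < e ->
  exists2 t, a <= t <= b & forall x, a <= x <= b -> c t - e < c x.
Proof.
move=> a0 ab e0.
have infc : has_inf [set c x | x in [set x | a <= x <= b]].
  split; first by exists (c a), a => //=; rewrite lexx ab.
  exists 0 => _ [x /andP[ax _] <-]; apply/ltW/c0; exact: le_trans ax.
have [_ [t tab <-] Ht] := inf_adherent e0 infc.
exists t => // x xab.
have : inf [set c x | x in [set x | a <= x <= b]] <= c x.
  by apply: ge_inf; [case: infc|exists x].
by lra.
Qed.

(** A uniform partition finer than [d] is tagged by near-minimizers of [c]. Its Riemann sum is
    within [e / 2] of [I], and lowering the values by [e / (2 * M)] over the length [M] costs
    another [e / 2]. *)
Lemma sub_primitive_integral M I (e : R) : 0 < M -> is_riemann_integral c 0 M I ->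
  0 < e -> exists L F, I - e < L /\ sub_primitive 0 M L F.
Proof.
move=> M0 cI e0.
have e2 : 0 < e / 2 by rewrite divr_gt0.
have [d d0 Hd] := cI _ e2.
have [N Nd] : exists N, M / d < N.+1%:R.
  exists (Num.truncn (M / d)).
  exact: truncnS_gt.
pose h := M / N.+1%:R; have h0 : 0 < h by rewrite divr_gt0.
have hd : h < d by rewrite /h ltr_pdivrMr// -ltr_pdivrMl// mulrC.
pose x (i : nat) := i%:R * h.
have xS i : x i.+1 = x i + h by rewrite /x -natr1 mulrDl mul1r.
have x0 i : 0 <= x i by apply: mulr_ge0; [exact: ler0n|exact: ltW].
have xN : x N.+1 = M by rewrite /x mulrC divfK.
pose e' := e / (2 * M); have e'0 : 0 < e' by rewrite divr_gt0 ?mulr_gt0.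
have /choice[t Ht] i : exists t, x i <= t <= x i.+1 /\
    forall y, x i <= y <= x i.+1 -> c t - e' < c y.
  have [|t ? ?] := @near_inf (x i) (x i.+1) e' (x0 i) _ e'0.
    by rewrite xS lerDl ltW.
  by exists t.
(* Truncation at 0 keeps slopes nonnegative; since [c] is positive they remain below [c]. *)
pose m i := Num.max (c (t i) - e') 0.
have subF i : exists F, sub_primitive 0 (x i) (\sum_(0 <= j < i) m j * h) F.
  elim: i => [|i [F HF]].
    by rewrite big_nil /x mul0r; exists (fun=> 0); exact: sub_primitive_point.
  rewrite big_nat_recr//=; eexists; apply: sub_primitive_cat HF _ => //.
    by rewrite xS lerDl ltW.
  rewrite (_ : h = x i.+1 - x i); last by rewrite xS addrAC subrr add0r.
  apply: sub_primitive_linear => //; first by rewrite le_max lexx orbT.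
  move=> y yi; rewrite gt_max (proj2 (Ht i) y yi) c0//.
  by case/andP: yi => yi _; exact: le_trans yi.
have [F HF] := subF N.+1; rewrite xN in HF.
exists (\sum_(0 <= j < N.+1) m j * h), F; split => //.
pose s := mkseq (fun i => x i.+1) N.+1.
have nthx i : (i <= N.+1)%N -> nth M (0 :: s) i = x i.
  case: i => [|i] iN; first by rewrite /= /x mul0r.
  by rewrite /= nth_mkseq.
have part : itv_partition 0 M s.
  split.
    apply/(pathP M) => i; rewrite size_mkseq => iN.
    rewrite -[nth M s i]/(nth M (0 :: s) i.+1) !nthx// ?(ltnW iN)//.
    by rewrite xS ltrDl.
  rewrite (last_nth M) size_mkseq nthx// xN //.
have := Hd s t part _.
rewrite /riemann_sum size_mkseq => Hsum.
have {Hsum} : `|\sum_(0 <= i < N.+1) c (t i) * h - I| < e / 2.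
  have incrE (X : nat -> R) (i : nat) : (forall i, (i <= N.+1)%N -> X i = x i) ->
      (i < N.+1)%N -> X i.+1 - X i = h.
    by move=> XE iN; rewrite (XE _ iN) (XE _ (ltnW iN)) xS addrAC subrr add0r.
  have sumE (X : nat -> R) : (forall i, (i <= N.+1)%N -> X i = x i) ->
      \sum_(0 <= i < N.+1) c (t i) * (X i.+1 - X i) =
      \sum_(0 <= i < N.+1) c (t i) * h.
    by move=> XE; apply: eq_big_nat => i /andP[_ iN]; rewrite incrE.
  rewrite -(sumE _ nthx); apply: Hsum => i iN; split.
    by rewrite (nthx _ iN) (nthx _ (ltnW iN)); case: (Ht i).
  by rewrite (incrE _ _ nthx iN).
rewrite ltr_norml => /andP[H _].
have : \sum_(0 <= i < N.+1) (c (t i) - e') * h <= \sum_(0 <= j < N.+1) m j * h.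
  by apply: ler_sum => i _; rewrite ler_pM2r// le_max lexx.
have -> : \sum_(0 <= i < N.+1) (c (t i) - e') * h =
    \sum_(0 <= i < N.+1) c (t i) * h - e / 2.
  under eq_bigr do rewrite mulrBl.
  rewrite sumrB; congr (_ - _).
  rewrite sumr_const_nat subn0 -[LHS]mulr_natr -mulrA /h divfK// /e' invfM.
  by rewrite mulrA divfK// gt_eqF.
lra.
Qed.

Hypothesis c_int : forall a b, 0 <= a -> a <= b -> riemann_integrable c a b.
Hypothesis c_oo : riemann_integral c 0 b @[b --> +oo] --> +oo.

Lemma sub_primitive_unbounded (A : R) : exists M L F, [/\ 0 < M, A < L &
  sub_primitive 0 M L F].
Proof.
have [M [M0 IM]] : exists M, 0 < M /\ A + 1 < riemann_integral c 0 M.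
  have /filter_ex[M [M0 IM]] : \forall M \near +oo, 0 < M /\ A + 1 < riemann_integral c 0 M.
    near=> M; split; near: M; first exact: nbhs_pinfty_gt.
    by move/cvgryPgt : c_oo; exact.
  by exists M.
(* [riemann_integral] is a chosen value, and integrability makes it an integral. *)
have cI : is_riemann_integral c 0 M (riemann_integral c 0 M).
  by apply: getPex; apply: c_int => //; exact: ltW.
have [L [F [IL HF]]] := sub_primitive_integral M0 cI ltr01.
by exists M, L, F; split => //; lra.
Unshelve. all: by end_near. Qed.

End SubPrimitive.

(** * Continuation of local inverses *)

Lemma continuous_eball (R : realType) m n (G : 'rV[R]_m -> 'rV[R]_n) u (e : R) :
  {for u, continuous G} -> 0 < e -> exists2 d : R, 0 < d &
    forall v, enorm (v - u) < d -> enorm (G v - G u) < e.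
Proof.
move=> Gc e0; have /nbhs_eballP[d d0 Hd] : nbhs u [set v | enorm (G v - G u) < e].
  exact: (@enorm_cvgP _ _ _ (nbhs u) _ G (G u)).1 Gc e e0.
by exists d => // v /Hd.
Qed.

Lemma continuous_path (R : realType) n (X : R -> 'rV[R]_n) t (e : R) :
  {for t, continuous X} -> 0 < e -> exists2 d : R, 0 < d &
    forall s, `|s - t| < d -> enorm (X s - X t) < e.
Proof.
move=> Xc e0; have /nbhs_ballP[d d0 Hd] : nbhs t [set s | enorm (X s - X t) < e].
  exact: (@enorm_cvgP _ _ _ (nbhs t) _ X (X t)).1 Xc e e0.
by exists d => // s st; apply: Hd; rewrite /ball/= distrC.
Qed.

Lemma expanding_increments_sub (R : realType) n (f : 'rV[R]_n -> 'rV[R]_n) U V k k' :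
  U `<=` V -> k <= k' -> expanding_increments f V k' -> expanding_increments f U k.
Proof.
move=> UV kk' fV v; have [w w1 Hw] := fV v; exists w => // y Uy Uyv.
apply: le_trans (Hw y (UV _ Uy) (UV _ Uyv)).
by rewrite ler_wpM2r ?enorm_ge0.
Qed.

Lemma covering_increments_sub (R : realType) n (f : 'rV[R]_n -> 'rV[R]_n) U V k k' :
  U `<=` V -> k <= k' -> covering_increments f V k' -> covering_increments f U k.
Proof.
move=> UV kk' fV e e0; have [v v1 Hv] := fV e e0; exists v => // t t0 y Uy Uyv.
apply: le_trans (Hv t t0 y (UV _ Uy) (UV _ Uyv)).
by rewrite ler_wpM2l// ler_wpM2r ?enorm_ge0.
Qed.

Lemma eball_sub (R : realType) n (x y : 'rV[R]_n) r s :
  enorm (y - x) + s <= r -> eball y s `<=` eball x r.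
Proof.
move=> H z; rewrite /eball /=; have := enormB_le z y x; lra.
Qed.

Section Global.
Variables (R : realType) (n : nat) (f : 'rV[R]_n -> 'rV[R]_n) (c : R -> R).
Hypotheses (f_cont : continuous f) (c0 : forall t, 0 <= t -> 0 < c t).
Hypothesis c_int : forall a b, 0 <= a -> a <= b -> riemann_integrable c a b.
Hypothesis c_oo : riemann_integral c 0 b @[b --> +oo] --> +oo.
Hypothesis f_local : forall x k, 0 < k < c (enorm x) -> exists2 r : R, 0 < r &
  expanding_increments f (eball x r) k /\ covering_increments f (eball x r) k.

(* Along a lift [X] of a segment of length [U], the sub-primitive [F] of [c]
   evaluated at [enorm (X t)] grows at most as fast as [f (X t)]. *)
Lemma lift_bound (M L U : R) (F : R -> R) (X : R -> 'rV[R]_n) : 0 < M -> U < L ->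
  sub_primitive c 0 M L F ->
  (forall t, 0 <= t <= 1 -> {for t, continuous X}) -> X 0 = 0 ->
  (forall s t, 0 <= s <= 1 -> 0 <= t <= 1 ->
     enorm (f (X s) - f (X t)) <= U * `|s - t|) ->
  enorm (X 1) < M.
Proof.
move=> M0 UL [F0 FM HF] Xc X0 XU.
have Xdist t e : 0 <= t <= 1 -> 0 < e -> exists2 d : R, 0 < d &
    forall s, `|s - t| < d -> enorm (X s - X t) < e.
  by move=> t01; apply: continuous_path; exact: Xc.
(* Truncation at [M] keeps the argument of [F] in [[0, M]]; beyond [M] the function [g] is locally
   constant. *)
pose g t := Num.min (enorm (X t)) M.
have g0M t : 0 <= g t <= M by rewrite le_min enorm_ge0 ltW//= ge_min lexx orbT.
have gdist s t : `|g s - g t| <= enorm (X s - X t).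
  apply: le_trans (enorm_dist (X s) (X t)); rewrite /g.
  wlog st : s t / enorm (X t) <= enorm (X s).
    move=> H; case/orP: (le_total (enorm (X t)) (enorm (X s))) => /H //.
    by rewrite distrC (distrC (enorm _)).
  rewrite !ger0_norm ?subr_ge0 ?le_min ?ge_min ?st ?lexx ?orbT//.
  by case: (leP (enorm (X s)) M); case: (leP (enorm (X t)) M) => ? ?; lra.
have Fg_cont t : 0 <= t <= 1 -> {for t, continuous (F \o g)}.
  move=> t01; apply/cvg_realP => e e0.
  have [k /andP[k0 _] [d d0 Hd]] := HF (g t) (g0M t).
  have ek : 0 < Num.min d (e / k) by rewrite lt_min d0 divr_gt0.
  have [d' d'0 Hd'] := Xdist t _ t01 ek.
  exists d' => // s /Hd' st; have := le_lt_trans (gdist s t) st.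
  rewrite lt_min => /andP[gd ge]; apply: le_lt_trans (Hd _ (g0M s) gd) _.
  by rewrite mulrC -ltr_pdivlMr.
have : F (g 1) - F (g 0) <= U * (1 - 0).
  suff : - U * (1 - 0) <= - F (g 1) - - F (g 0) by lra.
  apply: (@right_slope_ge _ (fun t => - F (g t)) 0 1 (- U) ler01).
    by move=> t /Fg_cont Ht; apply: (@cvgN _ _ _ (nbhs t)); exact: Ht.
  move=> t /andP[t0 t1]; have t01 : 0 <= t <= 1 by rewrite t0 ltW.
  have U0 s : t < s <= 1 -> 0 <= U * (s - t).
    move=> /andP[ts s1]; have := XU s t _ t01; rewrite s1 (le_trans t0 (ltW ts)).
    move=> /(_ isT)/(le_trans (enorm_ge0 _)).
    by rewrite gtr0_norm ?subr_gt0.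
  have [Mt|tM] := ltP M (enorm (X t)).
    have [|d d0 Hd] := Xdist t (enorm (X t) - M) t01; first by rewrite subr_gt0.
    exists (Num.min d (1 - t)); first by rewrite lt_min d0 subr_gt0.
    move=> s /andP[ts]; rewrite -ltrBlDl lt_min => /andP[sd s1].
    have /Hd sX : `|s - t| < d by rewrite gtr0_norm ?subr_gt0.
    have Ms : M < enorm (X s).
      have := enormB_le (X t) (X s) 0; rewrite !subr0 (enormC (X t)); lra.
    rewrite /g (min_r (ltW Mt)) (min_r (ltW Ms)) subrr mulNr oppr_le0.
    by apply: U0; rewrite ts /=; lra.
  have gt : g t = enorm (X t) by rewrite /g min_l.
  have [k kc [d d0 Hd]] := HF (g t) (g0M t).
  (* The slope [k] of [F] lies strictly below [c] at [enorm (X t)], so it is also a rate of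
     expansion of [f] near [X t]. *)
  have [r r0 [fr _]] := f_local (x := X t) (k := k) ltac:(rewrite -gt; exact: kc).
  have [k0 _] := andP kc.
  have m0 : 0 < Num.min d r by rewrite lt_min d0.
  have [d' d'0 Hd'] := Xdist t _ t01 m0.
  exists (Num.min d' (1 - t)); first by rewrite lt_min d'0 subr_gt0.
  move=> s /andP[ts]; rewrite -ltrBlDl lt_min => /andP[sd s1].
  have /Hd' : `|s - t| < d' by rewrite gtr0_norm ?subr_gt0.
  rewrite lt_min => /andP[Xd Xr].
  have s01 : 0 <= s <= 1 by apply/andP; split; lra.
  have := XU s t s01 t01; rewrite [`|s - t|]gtr0_norm ?subr_gt0// => H1.
  have Xtt : eball (X t) r (X t) by rewrite /eball /= subrr enorm0.
  have H2 := expanding_norm fr Xtt (Xr : eball (X t) r (X s)).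
  have H3 := Hd _ (g0M s) (le_lt_trans (gdist s t) Xd).
  have H4 : k * `|g s - g t| <= k * enorm (X s - X t) by rewrite ler_pM2l.
  have := ler_norm (F (g s) - F (g t)); rewrite mulNr; lra.
rewrite /g X0 enorm0 (min_l (ltW M0)) F0 subr0 subr0 mulr1 => FU.
rewrite ltNge; apply/negP => MX; move: FU; rewrite min_r// FM; lra.
Qed.

(** Both bounds weaken as radius or rate decreases, so one number can stand for both and a Lebesgue
    number applies. *)
Lemma uniform_local (M : R) : exists2 d : R, 0 < d & forall y, enorm y <= M ->
  expanding_increments f (eball y d) d /\ covering_increments f (eball y d) d.
Proof.
have [x _|d d0 Hd] := @Lebesgue_number _ _ [set y | enorm (y - 0) <= M]
    (fun x r => expanding_increments f (eball x r) r /\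
      covering_increments f (eball x r) r) (@compact_closed_eball _ _ 0 M).
  pose k := c (enorm x) / 2.
  have cx := c0 (enorm_ge0 x).
  have [|r r0 [fe fc]] := @f_local x k; first by rewrite /k; apply/andP; split; lra.
  exists (Num.min r k); first by rewrite lt_min r0 divr_gt0.
  have sub : eball x (Num.min r k) `<=` eball x r.
    by move=> y xy; apply: lt_le_trans xy _; rewrite ge_min lexx.
  have mk : Num.min r k <= k by rewrite ge_min lexx orbT.
  split; first exact: expanding_increments_sub sub mk fe.
  exact: covering_increments_sub sub mk fc.
exists d => // y yM; have [|x [r [[fe fc] xyr]]] := Hd y; first by rewrite /= subr0.
have dr : d <= r by have := enorm_ge0 (y - x); lra.
split; first exact: expanding_increments_sub (eball_sub xyr) dr fe.
exact: covering_increments_sub (eball_sub xyr) dr fc.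
Qed.

Lemma expanding_injective U k y z : 0 < k -> expanding_increments f U k ->
  U y -> U z -> f y = f z -> y = z.
Proof.
move=> k0 fU Uy Uz fyz; have := expanding_norm fU Uy Uz.
rewrite fyz subrr enorm0 pmulr_rle0// => yz.
apply/eqP; rewrite eq_sym -subr_eq0 -enorm_eq0.
by apply/eqP/le_anti; rewrite yz enorm_ge0.
Qed.

(** A lift of the dilation of ratio [lam] centered at [f 0], over a fixed ball; continuation lets
    [lam] grow from 0 to 1. *)
Definition section_on (rho lam : R) (G : 'rV[R]_n -> 'rV[R]_n) :=
  G 0 = 0 /\ forall u, enorm u < rho ->
    {for u, continuous G} /\ f (G u) = f 0 + lam *: u.

Lemma section_bound rho M L F lam G : 0 < M -> rho < L -> sub_primitive c 0 M L F ->
  0 <= lam <= 1 -> section_on rho lam G ->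
  forall u, enorm u < rho -> enorm (G u) < M.
Proof.
move=> M0 rL HF /andP[l0 l1] [G0 HG] u ur.
have inr t : 0 <= t <= 1 -> enorm (t *: u) < rho.
  move=> /andP[t0 t1]; apply: le_lt_trans ur.
  by rewrite enormZ ger0_norm// ler_piMl ?enorm_ge0.
have uL : enorm u < L by lra.
rewrite -[u]scale1r; apply: (@lift_bound M L (enorm u) F (fun t => G (t *: u))) => //.
- move=> t /inr tr; apply: (@cvg_comp _ _ _ (fun t => t *: u) G (nbhs t) (nbhs (t *: u))).
    by apply: cvgZr_tmp; exact: cvg_id.
  by case: (HG _ tr).
- by rewrite scale0r.
move=> s t s01 t01; have [_ ->] := HG _ (inr s s01); have [_ ->] := HG _ (inr t t01).
rewrite opprD addrACA subrr add0r -scalerBr -scalerBl enormZ enormZ ger0_norm//.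
rewrite [leRHS]mulrC; apply: ler_piMl => //.
by rewrite mulr_ge0 ?enorm_ge0.
Qed.

(** The bound [M] does not depend on [lam], so one [d] serves all steps. Each step moves targets by
    less than [eta]; local covering supplies the new preimages and expansion makes their choice
    continuous. *)
Lemma section_exists rho : 0 < rho -> exists G, section_on rho 1 G.
Proof.
move=> rho0.
have [M [L [F [M0 rL HF]]]] := sub_primitive_unbounded c0 c_int c_oo rho.
have [d d0 Hd] := uniform_local M.
(* The radius [k * s / 2] of [local_covering], for [k = d] and [s = d / 2]. *)
pose eta := d * (d / 2) / 2; have eta0 : 0 < eta by rewrite !(divr_gt0, mulr_gt0).
have [N Nr] : exists N, rho / eta < N.+1%:R.
  by exists (Num.truncn (rho / eta)); exact: truncnS_gt.
pose mu : R := N.+1%:R^-1; have mu0 : 0 < mu by rewrite invr_gt0.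
have mueta : mu * rho < eta by rewrite mulrC ltr_pdivrMr// -ltr_pdivrMl// mulrC.
have half y q : enorm y <= M -> enorm (q - f y) < eta ->
    exists z, enorm (z - y) <= d / 2 /\ f z = q.
  move=> yM yq; have [fe fc] := Hd y yM.
  have d2 : 0 < d / 2 < d by apply/andP; split; lra.
  by have [z zy fz] := local_covering f_cont d0 d2 fe fc yq; exists z.
suff H k : (k <= N.+1)%N -> exists G, section_on rho (k%:R * mu) G.
  by have [//|G] := H N.+1; rewrite mulfV ?gt_eqF//; exists G.
elim: k => [_|k IH kN].
  exists (fun=> 0); split => // u _; split; first exact: cst_continuous.
  by rewrite mul0r scale0r addr0.
have [G HG] := IH (ltnW kN); have [G0 GP] := HG.
set lam := k%:R * mu in HG GP.
have lam01 : 0 <= lam <= 1.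
  apply/andP; split; first by apply: mulr_ge0; [exact: ler0n|exact: ltW].
  by rewrite ler_pdivrMr// mul1r ler_nat ltnW.
have lamS : k.+1%:R * mu = lam + mu by rewrite -natr1 mulrDl mul1r.
have GM := section_bound M0 rL HF lam01 HG.
have /choice[G' HG'] u : exists z, enorm u < rho ->
    enorm (z - G u) <= d / 2 /\ f z = f 0 + (lam + mu) *: u.
  have [ur|] := ltP (enorm u) rho; last by move=> _; exists 0.
  have [_ fGu] := GP u ur.
  have [|z Hz] := @half (G u) (f 0 + (lam + mu) *: u) (ltW (GM u ur)).
    rewrite fGu opprD addrACA subrr add0r scalerDl addrAC subrr add0r.
    rewrite enormZ gtr0_norm//; apply: lt_trans mueta.
    by rewrite ltr_pM2l.
  by exists z.
exists G'; split.
  have [zz fz] := HG' 0 ltac:(by rewrite enorm0).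
  rewrite G0 subr0 scaler0 addr0 in zz fz.
  have [fe _] := Hd 0 ltac:(by rewrite enorm0 ltW).
  apply: (expanding_injective d0 fe) => //; rewrite /eball /= subr0 ?enorm0//.
  by apply: le_lt_trans zz _; lra.
move=> u ur; have [uG' fG'] := HG' u ur; split; last by rewrite lamS.
have [Gc _] := GP u ur.
have [fe _] := Hd (G u) (ltW (GM u ur)).
apply: (@enorm_cvgP _ _ _ (nbhs u) _ G' (G' u)).2 => e e0.
(* The bounds [d / 4] between values of [G] and [d / 2] from [G] to [G'] put both values of [G'] in
   the ball of radius [d] around [G u], where [f] expands. *)
have d4 : 0 < d / 4 by rewrite divr_gt0.
have [d1 d10 Hd1] := continuous_eball Gc d4.
have lm : 0 < lam + mu by case/andP: lam01 => ? _; lra.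
pose e1 := Num.min d1 (Num.min (rho - enorm u) (d * e / (lam + mu))).
apply/nbhs_eballP; exists e1.
  by rewrite !lt_min d10 subr_gt0 ur divr_gt0// mulr_gt0.
move=> u'; rewrite /eball /= !lt_min => /and3P[ud1 udr ude].
have u'r : enorm u' < rho.
  by have := enormB_le u' u 0; rewrite !subr0; lra.
have [u'G' fu'G'] := HG' u' u'r.
have := Hd1 u' ud1; rewrite /= => GG.
have in1 : eball (G u) d (G' u) by apply: le_lt_trans uG' _; lra.
have in2 : eball (G u) d (G' u').
  by have := enormB_le (G' u') (G u') (G u); rewrite /eball /=; lra.
have := expanding_norm fe in1 in2.
rewrite fu'G' fG' opprD addrACA subrr add0r -scalerBr enormZ gtr0_norm// => H.
rewrite -(ltr_pM2l d0); apply: le_lt_trans H _.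
by rewrite mulrC -ltr_pdivlMr.
Qed.

(** Uniqueness of lifts: [t *: a] and [G (f (t *: a) - f 0)] have the same image and agree at 0.
    Their coincidence set is closed by continuity and extends to the right by local injectivity. *)
Lemma section_cancel rho G a : section_on rho 1 G ->
  (forall t, 0 <= t <= 1 -> enorm (f (t *: a) - f 0) < rho) ->
  G (f a - f 0) = a.
Proof.
move=> [G0 GP] arho.
pose X t := G (f (t *: a) - f 0).
have fX t : 0 <= t <= 1 -> f (X t) = f (t *: a).
  by move=> t01; have [_ ->] := GP _ (arho t t01); rewrite scale1r subrKC.
have Xc t : 0 <= t <= 1 -> {for t, continuous X}.
  move=> t01.
  apply: (@cvg_comp _ _ _ (fun t => f (t *: a) - f 0) G (nbhs t)
    (nbhs (f (t *: a) - f 0))); last by case: (GP _ (arho t t01)).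
  apply: (@cvgB _ _ _ (nbhs t)); last exact: cvg_cst.
  apply: (@cvg_comp _ _ _ (fun t => t *: a) f (nbhs t) (nbhs (t *: a))).
    by apply: cvgZr_tmp; exact: cvg_id.
  exact: f_cont.
have Yc t : {for t, continuous (fun t : R => t *: a)}.
  by apply: cvgZr_tmp; exact: cvg_id.
have : X 1 = 1 *: a.
  apply: (@real_induction R (fun t => X t = t *: a) 0 1) => //.
  - by rewrite /X scale0r subrr G0.
  - move=> t t01 H; apply/eqP; rewrite -subr_eq0 -enorm_eq0.
    apply/negP => /negP XY0.
    set e := enorm _ in XY0; have e0 : 0 < e / 2.
      by rewrite divr_gt0// lt_def XY0 enorm_ge0.
    have [d d0 Hd] := continuous_path (Xc t t01) e0.
    have [d' d'0 Hd'] := continuous_path (Yc t) e0.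
    have [s [s01 /andP[ts st] Xs]] := H (Num.min d d') ltac:(by rewrite lt_min d0).
    have m1 : Num.min d d' <= d by rewrite ge_min lexx.
    have m2 : Num.min d d' <= d' by rewrite ge_min lexx orbT.
    have := Hd s ltac:(rewrite ler0_norm ?subr_le0//; lra).
    have := Hd' s ltac:(rewrite ler0_norm ?subr_le0//; lra).
    rewrite -Xs (enormC (X s) (X t)) => H1 H2.
    by have := enormB_le (X t) (X s) (t *: a); rewrite -/e; lra.
  move=> t /andP[t0 t1] Xt; have t01 : 0 <= t <= 1 by rewrite t0 ltW.
  have ct := c0 (enorm_ge0 (t *: a)); set k := c (enorm (t *: a)) / 2.
  have k0 : 0 < k by rewrite divr_gt0.
  have [|r r0 [fe _]] := @f_local (t *: a) k; first by rewrite k0 /k /=; lra.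
  have [d d0 Hd] := continuous_path (Xc t t01) r0.
  have [d' d'0 Hd'] := continuous_path (Yc t) r0.
  pose m := Num.min (1 - t) (Num.min d d').
  have m0 : 0 < m by rewrite !lt_min subr_gt0 t1 d0.
  have m1 : m <= 1 - t by rewrite ge_min lexx.
  have m2 : m <= d by rewrite !ge_min lexx orbT.
  have m3 : m <= d' by rewrite !ge_min lexx !orbT.
  pose s := t + m / 2; have ts : t < s by rewrite /s; lra.
  have s1 : s <= 1 by rewrite /s; lra.
  exists s; split; first by rewrite ts.
  have sm : `|s - t| < m by rewrite gtr0_norm ?subr_gt0// /s; lra.
  apply: (expanding_injective k0 fe).
  - by rewrite /eball /= -Xt; apply: Hd; exact: lt_le_trans m2.
  - by rewrite /eball /=; apply: Hd'; exact: lt_le_trans m3.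
  - by apply: fX; rewrite s1 (le_trans t0) ?ltW.
by rewrite /X scale1r.
Qed.

Lemma segment_image_bounded a : exists2 rho : R, 0 < rho &
  forall t, 0 <= t <= 1 -> enorm (f (t *: a) - f 0) < rho.
Proof.
have nc : continuous (fun y => - enorm (f y - f 0)).
  move=> y; apply: (@cvgN _ _ _ (nbhs y)).
  apply: (@cvg_comp _ _ _ (fun y => f y - f 0) (@enorm R n) (nbhs y) (nbhs (f y - f 0))).
    by apply: (@cvgB _ _ _ (nbhs y)); [exact: f_cont|exact: cvg_cst].
  exact: enorm_continuous.
have [z _ Hz] := closed_eball_min 0 (enorm_ge0 a) nc.
exists (enorm (f z - f 0) + 1); first by rewrite ltr_wpDl ?enorm_ge0.
move=> t /andP[t0 t1]; have := Hz (t *: a); rewrite subr0 enormZ ger0_norm//.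
rewrite ler_piMl ?enorm_ge0// lerN2 => /(_ isT); lra.
Qed.

(** A section over a large ball recovers [a] from [f a], whence injectivity. Near each [q] the
    inverse is a translate of a section, whence continuity. *)
Lemma global_homeomorphism : homeomorphism f.
Proof.
split => //.
have f_surj q : exists a, f a = q.
  have [|G [_ GP]] := @section_exists (enorm (q - f 0) + 1).
    by rewrite ltr_wpDl ?enorm_ge0.
  exists (G (q - f 0)); have [|_ ->] := GP (q - f 0); first by rewrite ltrDl.
  by rewrite scale1r subrKC.
have f_inj a b : f a = f b -> a = b.
  move=> fab; have [r r0 Hr] := segment_image_bounded a.
  have [r' r'0 Hr'] := segment_image_bounded b.
  (* The radius [r + r'] makes one section valid for the images of both segments. *)
  have [|G HG] := @section_exists (r + r'); first by rewrite addr_gt0.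
  rewrite -(@section_cancel _ G a HG) => [|t t01]; last by have := Hr t t01; lra.
  rewrite fab; apply: (section_cancel HG) => t t01; have := Hr' t t01; lra.
have /choice[g fg] := f_surj.
have gf : cancel f g by move=> a; apply: f_inj; rewrite fg.
exists g; split => // q.
have [|G [_ GP]] := @section_exists (enorm (q - f 0) + 1).
  by rewrite ltr_wpDl ?enorm_ge0.
have gE q' : enorm (q' - f 0) < enorm (q - f 0) + 1 -> g q' = G (q' - f 0).
  by move=> /GP[_ fG]; apply: f_inj; rewrite fg fG scale1r subrKC.
have [|Gc _] := GP (q - f 0); first by rewrite ltrDl.
apply: (@enorm_cvgP _ _ _ (nbhs q) _ g (g q)).2 => e e0.
have [d d0 Hd] := continuous_eball Gc e0.
apply/nbhs_eballP; exists (Num.min d 1); first by rewrite lt_min d0 ltr01.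
move=> q'; rewrite /eball /= lt_min => /andP[qd q1].
rewrite !gE; [|by rewrite ltrDl|by have := enormB_le q' q (f 0); lra].
by apply: Hd; rewrite opprD addrACA subrr addr0.
Qed.

End Global.

Theorem theorem6p3 (R : realType) (D : forall n : nat, set (set 'rV[R]_n))
    (hD : o_minimal D) (n : nat) (f : 'rV[R]_n -> 'rV[R]_n)
    (f_cont : continuous f) (f_def : definable_map D f)
    (hc : exists c : R -> R,
       [/\ forall t, 0 <= t -> 0 < c t,
           forall a b, 0 <= a -> a <= b -> riemann_integrable c a b,
           riemann_integral c 0 b @[b --> +oo] --> +oo &
           forall x : 'rV[R]_n, ((c (enorm x))%:E <= nu f x)%E]) :
  homeomorphism f.
Proof.
have [c [c0 c_int c_oo c_nu]] := hc.
apply: (global_homeomorphism f_cont c0 c_int c_oo) => x k /andP[k0 kc].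
have [r r0 Hr] := nu_expanding (c_nu x) kc.
exists r => //; split; first exact: (expanding_incr hD f_cont f_def r0 k0 Hr).
exact: (covering_incr hD f_cont f_def r0 k0 Hr).
Qed.
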